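(* Let $\rho$ be a probability distribution on $\mathbb{R}^d\times\mathbb{R}$ with $\mathbb{E}\|a\|^2<\infty$ and $\mathbb{E}[b^2]<\infty$ for $(a,b)\sim\rho$, with $H=\mathbb{E}[aa^\top]$ invertible, and let $x_*$ be the unique minimizer of $\mathcal{R}(x)=\frac12\mathbb{E}_\rho(\langle x,a\rangle-b)^2$. Assume there are finite constants $R,\sigma,\tilde\kappa$ with (i) $\mathbb{E}[\|a\|^2\, aa^\top]\preccurlyeq R^2 H$, (ii) $\mathbb{E}[(b-\langle x_*,a\rangle)^2 aa^\top]\preccurlyeq \sigma^2 H$, (iii) $\mathbb{E}[\|a\|^2_{H^{-1}}\, aa^\top]\preccurlyeq \tilde\kappa H$. Run the algorithm AcSGD described in the context with step sizes $\alpha,\beta>0$ satisfying $(\alpha+2\beta)R^2\le 1$ and $\alpha\le \frac{\beta}{2\tilde\kappa}$. Then for every integer $T\ge 1$, the weighted average $\bar x_T=\frac{\sum_{t=0}^T (t+1)x_t}{\sum_{t=0}^T(t+1)}$ satisfies $$\mathbb{E}[\mathcal{R}(\bar x_T)]-\mathcal{R}(x_* )\le \min\left\{\frac{12}{\alpha T^2},\frac{48}{\beta T}\right\}\|x_0-x_*\|^2+\frac{72\,\sigma^2 d}{T}.$$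
   Context: $\preccurlyeq$ is the Loewner order on symmetric matrices, and $\|a\|^2_{H^{-1}}=a^\top H^{-1}a$. Samples $(a_t,b_t)_{t\ge0}$ are drawn i.i.d. from $\rho$. AcSGD: given $x_0\in\mathbb{R}^d$, set $z_0=x_0$ and for $t\ge0$ let $g_t=a_t(\langle a_t,x_t\rangle-b_t)$ (the stochastic gradient at $x_t$ using the sample $(a_t,b_t)$) and $y_{t+1}=x_t-\beta g_t$, $z_{t+1}=z_t-\alpha(t+1)g_t$, $(t+2)x_{t+1}=(t+1)y_{t+1}+z_{t+1}$. Expectation is over the samples. *)

(* Defs.v *)
From HB Require Import structures.
From mathcomp Require Import all_boot all_order all_algebra.
From mathcomp Require Import all_classical all_reals all_analysis.

Set Implicit Arguments.
Unset Strict Implicit.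
Unset Printing Implicit Defensive.

Import Order.TTheory GRing.Theory Num.Theory.
Local Open Scope classical_set_scope.
Local Open Scope ring_scope.

Definition dotv {R : realType} {n : nat} (u v : 'cV[R]_n) : R :=
  \sum_(i < n) u i 0 * v i 0.

Definition qform {R : realType} {n : nat} (A : 'M[R]_n) (v : 'cV[R]_n) : R :=
  (v^T *m A *m v) 0 0.

Definition second_moment {R : realType} {dX} {X : measurableType dX} {n : nat}
  (rho : probability X R) (a : X -> 'cV[R]_n) : 'M[R]_n :=
  \matrix_(i, j) (\int[rho]_z (a z i 0 * a z j 0))%R.

(* Loewner inequality  E_rho[w aa^T] <= c H  between a PSD-valued random matrix
   expectation and c H, written through quadratic forms:
   for every v,  E_rho[w <v,a>^2] <= c v^T H v  (LHS in [0,+oo]). *)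
Definition loewner_le_expect {R : realType} {dX} {X : measurableType dX} {n : nat}
  (rho : probability X R) (a : X -> 'cV[R]_n) (w : X -> R) (c : R) (H : 'M[R]_n) : Prop :=
  forall v : 'cV[R]_n,
    (\int[rho]_z ((w z * dotv v (a z) ^+ 2)%:E) <= (c * qform H v)%:E)%E.

Definition risk {R : realType} {dX} {X : measurableType dX} {n : nat}
  (rho : probability X R) (a : X -> 'cV[R]_n) (b : X -> R) (x : 'cV[R]_n) : \bar R :=
  ((2^-1)%:E * \int[rho]_z (((dotv x (a z) - b z) ^+ 2)%:E))%E.

Definition mutually_independent {R : realType} {d dX} {T : measurableType d}
  {X : measurableType dX} (P : probability T R) (xi : nat -> T -> X) : Prop :=
  forall (s : seq nat) (B : nat -> set X), uniq s ->
    (forall j, j \in s -> measurable (B j)) ->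
    P (\big[setI/setT]_(j <- s) (xi j @^-1` B j)) =
    (\prod_(j <- s) P (xi j @^-1` B j))%E.

Definition iid_with_law {R : realType} {d dX} {T : measurableType d}
  {X : measurableType dX} (P : probability T R) (rho : probability X R)
  (xi : nat -> T -> X) : Prop :=
  [/\ forall t, measurable_fun setT (xi t),
      forall t (B : set X), measurable B -> P (xi t @^-1` B) = rho B
    & mutually_independent P xi].

(* AcSGD iterates driven by deterministic sample sequences A (features) and
   B (labels).  State at time t is (x_t, z_t); y_{t+1} is computed inline. *)
Fixpoint acsgd_state {R : realType} {n : nat} (alpha beta : R) (x0 : 'cV[R]_n)
  (A : nat -> 'cV[R]_n) (B : nat -> R) (t : nat) : 'cV[R]_n * 'cV[R]_n :=
  match t with
  | 0 => (x0, x0)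
  | t'.+1 =>
      let xz := acsgd_state alpha beta x0 A B t' in
      let x := xz.1 in
      let z := xz.2 in
      let g := (dotv (A t') x - B t') *: A t' in
      let y' := x - beta *: g in
      let z' := z - (alpha * (t'.+1)%:R) *: g in
      let x' := ((t'.+2)%:R)^-1 *: ((t'.+1)%:R *: y' + z') in
      (x', z')
  end.

Definition acsgd_x {R : realType} {n : nat} (alpha beta : R) (x0 : 'cV[R]_n)
  (A : nat -> 'cV[R]_n) (B : nat -> R) (t : nat) : 'cV[R]_n :=
  (acsgd_state alpha beta x0 A B t).1.

Definition acsgd_xbar {R : realType} {n : nat} (alpha beta : R) (x0 : 'cV[R]_n)
  (A : nat -> 'cV[R]_n) (B : nat -> R) (T : nat) : 'cV[R]_n :=
  (\sum_(t < T.+1) (t.+1)%:R)^-1 *: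
    \sum_(t < T.+1) ((t.+1)%:R *: acsgd_x alpha beta x0 A B t).

(* Main.v *)
(* Put [s_t = (t+1)(x_t - xstar)] and [v_t = z_t - xstar]. With
   [G_t = a_t (<a_t, s_t> - (t+1) eps_t)], [eps = b - <xstar, a>], AcSGD becomes
   the linear recursion with constant coefficients
     s_(t+1) = s_t + v_t - (alpha + beta) G_t,   v_(t+1) = v_t - alpha G_t,
   and [xbar_T - xstar] is a multiple of [S = s_0 + ... + s_T]. By linearity [S]
   splits into a bias part (no [eps]) and a variance part (zero start). Second
   moments of linear functionals [u] of the state satisfy
     E <u, state_(t+1)>^2 <= E <adj u, state_t>^2 + E[<r,a>^2 <a,s_t>^2]
                             + (t+1)^2 E[eps^2 <r,a>^2],
   where [r] is the gain of [u] and [adj] the adjoint of the mean dynamics, which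
   decouples in an eigenbasis of [H]. An explicit Lyapunov function gives
     sum_j lambda r_j^2 <= (2/3) alpha / (beta lambda) + (alpha + 2 beta) / 3
   along adjoint orbits; hypotheses (i) and (iii) and the step size conditions
   turn this into the factor 2/3 < 1, so the multiplicative noise can be absorbed
   at the price of a factor 3.
   Bias: sum_t E|s_t|_H^2 is at most 3 times its noiseless value, and the latter
   is bounded by energies of the scalar recursions; Cauchy-Schwarz passes to [S].
   Variance: E<p,s_t>^2 <= 3 t^2 sigma^2 W(p), hence the total noise at time [t]
   is at most 3 (t+1)^2 sigma^2 |r|_H^2, while the gains of the adjoint recursion
   with source [m] obey |lambda r| <= 3 |m|. *)
Require Import Defs.
From HB Require Import structures.
From mathcomp Require Import all_boot all_order all_algebra.
From mathcomp Require Import all_classical all_reals all_analysis.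
From mathcomp Require Import measurable_realfun spectral complex ring lra.

Import Order.TTheory GRing.Theory Num.Theory.
Local Open Scope classical_set_scope.
Local Open Scope ring_scope.

(** * Independence of a sample from its past *)

(** Bundles the image measure and exposes only its values, which is all that uniqueness theorems for
    measures require. *)
Lemma pushforward_measure {R : realType} {d1 d2 : measure_display}
  {T1 : measurableType d1} {T2 : measurableType d2}
  (m : {measure set T1 -> \bar R}) (f : T1 -> T2) :
  measurable_fun setT f ->
  exists m' : {measure set T2 -> \bar R}, forall A, m' A = m (f @^-1` A).
Proof. by move=> mf; unshelve eexists (pushforward m f). Qed.

Section Independence.
Context {R : realType} {d dX : measure_display} {Omega : measurableType d}
  {X : measurableType dX} (P : probability Omega R) (rho : probability X R)
  (xi : nat -> Omega -> X).
Hypothesis xiP : iid_with_law P rho xi.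

Definition cylinder t (B : nat -> set X) : set Omega :=
  \big[setI/setT]_(j <- iota 0 t) (xi j @^-1` B j).

Definition cylinders t : set (set Omega) :=
  [set C | exists B, (forall j, measurable (B j)) /\ C = cylinder t B].

(** The points are those of [Omega], but the sigma-algebra is the one generated by the samples of
    index below [t]. Measurability on [past t] thus encodes dependence on the past only. *)
Definition past t : measurableType (sigma_display (cylinders t)) :=
  g_sigma_algebraType (cylinders t).

Lemma measurable_sample t : measurable_fun setT (xi t).
Proof. by case: xiP. Qed.

Lemma measurable_cylinder t B : (forall j, measurable (B j)) ->
  measurable (cylinder t B).
Proof.
move=> mB; rewrite /cylinder; elim/big_ind: _ => //.
  exact: measurableI.
by move=> j _; rewrite -[_ @^-1` _]setTI; exact: measurable_sample.
Qed.

Lemma cylinders_setI t : setI_closed (cylinders t).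
Proof.
move=> _ _ [B [mB ->]] [C [mC ->]].
exists (fun j => B j `&` C j); split; first by move=> j; exact: measurableI.
by rewrite /cylinder -big_split.
Qed.

Lemma cylindersT t : cylinders t setT.
Proof.
exists (fun=> setT); split => //.
by rewrite /cylinder big1.
Qed.

Lemma measurable_past t (A : set (past t)) :
  measurable A -> measurable (A : set Omega).
Proof.
have : <<s cylinders t >> `<=` @measurable _ Omega.
  apply: smallest_sub; first exact: sigma_algebra_measurable.
  by move=> _ [B [mB ->]]; exact: measurable_cylinder.
by move=> h /h.
Qed.

Definition to_past t : Omega -> past t := id.

Lemma measurable_to_past t : measurable_fun setT (to_past t).
Proof. by move=> _ A mA; rewrite setTI; exact: (@measurable_past t A mA). Qed.

Lemma measurable_sample_past t j : (j < t)%N ->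
  measurable_fun setT (xi j : past t -> X).
Proof.
move=> jt _ B mB; rewrite setTI; apply: sub_sigma_algebra.
exists (fun i => if i == j then B else setT); split.
  by move=> i; case: ifP.
rewrite /cylinder (bigD1_seq j) ?mem_iota ?iota_uniq//= eqxx big1 ?setIT//.
by move=> i /negbTE ->; rewrite preimage_setT.
Qed.

(** Extending the family [C] by [B] at index [t] turns the intersection into a cylinder of length
    [t + 1], and mutual independence factorises both cylinders. *)
Lemma cylinder_indep t (C : nat -> set X) (B : set X) :
  (forall j, measurable (C j)) -> measurable B ->
  P (cylinder t C `&` xi t @^-1` B) = (P (cylinder t C) * rho B)%E.
Proof.
move=> mC mB; case: xiP => _ xi_law indep.
pose D j := if j == t then B else C j.
have mD j : measurable (D j) by rewrite /D; case: ifP.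
have DC : cylinder t C = \big[setI/setT]_(j <- iota 0 t) (xi j @^-1` D j).
  apply: eq_big_seq => j; rewrite mem_iota add0n /= => jt.
  by rewrite /D (ltn_eqF jt).
have -> : cylinder t C `&` xi t @^-1` B =
    \big[setI/setT]_(j <- iota 0 t.+1) (xi j @^-1` D j).
  by rewrite -addn1 iotaD big_cat big_seq1 DC /D add0n eqxx.
rewrite DC !indep ?iota_uniq//.
by rewrite -addn1 iotaD big_cat big_seq1 /D add0n eqxx (xi_law t).
Qed.

(** Pi-lambda argument: for fixed [B], both sides are finite measures in [A] that agree on
    cylinders, a pi-system containing the whole space. *)
Lemma past_indep t (A : set (past t)) (B : set X) :
  measurable A -> measurable B ->
  P ((A : set Omega) `&` (xi t @^-1` B)) = (P (A : set Omega) * rho B)%E.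
Proof.
move=> mA mB.
have mxB : measurable (xi t @^-1` B).
  by rewrite -[X in measurable X]setTI; exact: measurable_sample.
have [m1 m1E] := pushforward_measure (mrestr P mxB) (to_past t) (measurable_to_past t).
have [m2 m2E] := pushforward_measure
  (mscale (NngNum (fine_ge0 (measure_ge0 rho B))) P) (to_past t) (measurable_to_past t).
have rB : (fine (rho B))%:E = rho B by rewrite fineK ?fin_num_measure.
have -> : P ((A : set Omega) `&` xi t @^-1` B) = m1 A by rewrite m1E.
have -> : (P (A : set Omega) * rho B)%E = m2 A.
  by rewrite m2E muleC -rB.
apply: (@measure_unique _ R (past t) (cylinders t) (fun=> setT) _ _ _ _ m1 m2 _ _
  A mA) => //.
- exact: cylinders_setI.
- by move=> _; exact: cylindersT.
- by rewrite bigcup_const//; exists 0%N.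
- move=> _ [C [mC ->]].
  rewrite m1E m2E; transitivity (P (cylinder t C) * rho B)%E.
    exact: cylinder_indep.
  by rewrite muleC -rB.
- have m1T : m1 setT = P (setT `&` xi t @^-1` B) by rewrite m1E.
  by move=> _; rewrite m1T setTI (le_lt_trans (probability_le1 _ _)) ?ltry.
Qed.

(** By [past_indep] the joint law of the past and the sample [t] is a product measure, so Tonelli
    applies. This replaces conditional expectation given the past. *)
Lemma integral_indep t (f : (past t * X)%type -> \bar R) :
  measurable_fun [set: (past t * X)%type] f -> (forall y, (0 <= f y)%E) ->
  (\int[P]_w f (w, xi t w) = \int[P]_w \int[rho]_z f (w, z))%E.
Proof.
move=> mf f0.
have mpair : measurable_fun setT (fun w => (to_past t w, xi t w)).
  by apply: measurable_fun_pair; [exact: measurable_to_past|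
    exact: measurable_sample].
pose H : {mfun Omega >-> past t} := HB.pack (to_past t)
  (isMeasurableFun.Build _ _ _ _ _ (measurable_to_past t)).
have [m mE] := pushforward_measure P _ mpair.
have mrect : forall A B, measurable A -> measurable B ->
    m (A `*` B) = (distribution P H A * rho B)%E.
  by move=> A B mA mB; rewrite mE; exact: past_indep.
have mu := product_measure_unique mrect.
have -> : (\int[P]_w f (w, xi t w) = \int[m]_y f y)%E.
  rewrite (eq_measure_integral (pushforward P (fun w => (to_past t w, xi t w)))).
    by rewrite ge0_integral_pushforward.
  by move=> A mA _; rewrite mE.
rewrite (eq_measure_integral (distribution P H \x rho)%E); last first.
  by move=> A mA _; apply/esym; exact: mu.
rewrite fubini_tonelli1//= ge0_integral_pushforward//.
  exact: measurable_fun_fubini_tonelli_F.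
by move=> y _; apply: integral_ge0.
Qed.
End Independence.

(** * Inner products and real eigenvectors *)

Section Dotv.
Context {R : realType} {n : nat}.
Implicit Types (u v w : 'cV[R]_n) (c : R).

Lemma dotvC u v : dotv u v = dotv v u.
Proof. by apply: eq_bigr => i _; rewrite mulrC. Qed.

Lemma dotvDl u v w : dotv (u + v) w = dotv u w + dotv v w.
Proof. by rewrite -big_split; apply: eq_bigr => i _; rewrite mxE mulrDl. Qed.

Lemma dotvZl c u v : dotv (c *: u) v = c * dotv u v.
Proof. by rewrite mulr_sumr; apply: eq_bigr => i _; rewrite mxE mulrA. Qed.

Lemma dotvDr u v w : dotv u (v + w) = dotv u v + dotv u w.
Proof. by rewrite dotvC dotvDl !(dotvC u). Qed.

Lemma dotvZr c u v : dotv u (c *: v) = c * dotv u v.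
Proof. by rewrite dotvC dotvZl dotvC. Qed.

Lemma dotvNl u v : dotv (- u) v = - dotv u v.
Proof. by rewrite -scaleN1r dotvZl mulN1r. Qed.

Lemma dotvNr u v : dotv u (- v) = - dotv u v.
Proof. by rewrite dotvC dotvNl dotvC. Qed.

Lemma dotv0l u : dotv 0 u = 0.
Proof. by rewrite -(scale0r 0) dotvZl mul0r. Qed.

Lemma dotv0r u : dotv u 0 = 0.
Proof. by rewrite dotvC dotv0l. Qed.

Lemma dotv_suml I (r : seq I) (P : pred I) (F : I -> 'cV[R]_n) u :
  dotv (\sum_(i <- r | P i) F i) u = \sum_(i <- r | P i) dotv (F i) u.
Proof.
elim/big_rec2: _ => [|i x y _ <-]; first exact: dotv0l.
by rewrite dotvDl.
Qed.

Lemma dotv_sumr I (r : seq I) (P : pred I) (F : I -> 'cV[R]_n) u :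
  dotv u (\sum_(i <- r | P i) F i) = \sum_(i <- r | P i) dotv u (F i).
Proof. by rewrite dotvC dotv_suml; apply: eq_bigr => i _; rewrite dotvC. Qed.

Lemma dotvv_ge0 u : 0 <= dotv u u.
Proof. by apply: sumr_ge0 => i _; rewrite -expr2 sqr_ge0. Qed.

Lemma dotvv_gt0 u : u != 0 -> 0 < dotv u u.
Proof.
move=> u0; rewrite lt_neqAle dotvv_ge0 andbT; apply: contra u0 => /eqP/esym uu.
apply/eqP/matrixP => i j; rewrite ord1 mxE; apply/eqP; rewrite -sqrf_eq0 expr2.
move/eqP: uu; rewrite psumr_eq0; last by move=> k _; rewrite -expr2 sqr_ge0.
by move=> /allP/(_ i); rewrite mem_index_enum => /(_ isT).
Qed.

Lemma dotv_mulmx (A : 'M[R]_n) u v : dotv u (A *m v) = (u^T *m A *m v) 0 0.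
Proof.
by rewrite -mulmxA mxE; apply: eq_bigr => i _; congr (_ * _); rewrite mxE.
Qed.

Lemma dotv_mulmx_tr (A : 'M[R]_n) u v :
  dotv (A *m u) v = dotv u (A^T *m v).
Proof.
rewrite dotvC !dotv_mulmx.
have tr1 (M : 'M[R]_1) : M 0 0 = M^T 0 0 by rewrite mxE.
by rewrite tr1 !trmx_mul trmxK mulmxA.
Qed.

End Dotv.

(* The complex unitary diagonalisation of [H] yields, by taking real and
   imaginary parts of its rows, a Parseval frame of real eigenvectors: it serves
   as an orthonormal eigenbasis, although the frame vectors may be dependent. *)
Lemma eigenframe {R : realType} {n : nat} (H : 'M[R]_n) : H^T = H ->
  exists (I : finType) (e : I -> 'cV[R]_n) (lam : I -> R),
    [/\ forall k, H *m e k = lam k *: e k,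
        forall k, exists2 v : 'cV[R]_n, v != 0 & H *m v = lam k *: v &
        forall x y : 'cV[R]_n, dotv x y = \sum_k dotv (e k) x * dotv (e k) y].
Proof.
move=> Hsym; pose HC : 'M[R[i]]_n := map_mx (real_complex R) H.
have HCsym : HC \is symmetricmx.
  apply/is_hermitianmxP; rewrite expr0 scale1r map_mx_id// /HC.
  by rewrite map_trmx Hsym.
have HCreal : HC \is a mxOver Num.real.
  by apply/mxOverP => i j; rewrite mxE complex_real.
have HCherm := realsym_hermsym HCsym HCreal.
have /hermitian_normalmx/orthomx_spectralP HCE := HCherm.
have Dreal := hermitian_spectral_diag_real HCherm.
set U := spectralmx HC in HCE; set D := spectral_diag HC in HCE Dreal.
have Uu : U \is unitarymx by exact: spectral_unitarymx.
have UHC : U *m HC = diag_mx D *m U.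
  by rewrite {1}HCE !mulmxA mulmxV ?unitarymx_unit// mul1mx.
pose lam k := complex.Re (D 0 k).
have DE k : D 0 k = (lam k)%:C%C.
  by rewrite RRe_real//; move/mxOverP: Dreal; apply.
pose er k : 'cV[R]_n := \col_i complex.Re (U k i).
pose em k : 'cV[R]_n := \col_i complex.Im (U k i).
have rowE k j : \sum_i U k i * HC i j = (lam k)%:C%C * U k j.
  have := congr1 (fun M : 'M[R[i]]_n => M k j) UHC.
  by rewrite mul_diag_mx !mxE DE.
have HCE' i j : HC i j = (H i j)%:C%C by rewrite mxE.
have ReM (z : R[i]) (c : R) : complex.Re (z * c%:C%C) = complex.Re z * c.
  by case: z => x y /=; rewrite mulr0 subr0.
have ImM (z : R[i]) (c : R) : complex.Im (z * c%:C%C) = complex.Im z * c.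
  by case: z => x y /=; rewrite mulr0 add0r.
have erE k : H *m er k = lam k *: er k.
  apply/matrixP => i j; rewrite ord1 !mxE.
  have := congr1 (@complex.Re R) (rowE k i).
  rewrite raddf_sum mulrC ReM mulrC => <-; apply: eq_bigr => l _.
  by rewrite /= HCE' ReM mulrC -[in LHS]Hsym !mxE.
have emE k : H *m em k = lam k *: em k.
  apply/matrixP => i j; rewrite ord1 !mxE.
  have := congr1 (@complex.Im R) (rowE k i).
  rewrite raddf_sum mulrC ImM mulrC => <-; apply: eq_bigr => l _.
  by rewrite /= HCE' ImM mulrC -[in LHS]Hsym !mxE.
exists ('I_n * bool)%type, (fun k => if k.2 then er k.1 else em k.1),
  (fun k => lam k.1); split.
- by move=> [k []] /=.
(* A frame vector may be zero, so a true eigenvector is produced separately: the real and imaginary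
   parts of a row of a unitary matrix cannot both vanish. *)
- move=> [k b] /=; have [er0|ern0] := eqVneq (er k) 0; last first.
    by exists (er k).
  exists (em k); last exact: emE.
  apply/eqP => em0.
  have /matrixP/(_ k k) := unitarymxP Uu.
  rewrite !mxE eqxx big1 => [/eqP|i _]; first by rewrite eq_sym oner_eq0.
  have := congr1 (fun v : 'cV[R]_n => v i 0) er0.
  have := congr1 (fun v : 'cV[R]_n => v i 0) em0.
  by rewrite !mxE; case: (U k i) => x y /= -> ->; rewrite mul0r.
- move=> x y.
  (* The Parseval identity is the real part of [U^* U = 1], read entry by entry. *)
  have UU := mulVmx (unitarymx_unit Uu); rewrite invmx_unitary// in UU.
  have frame i j :
      \sum_k (er k i 0 * er k j 0 + em k i 0 * em k j 0) = (i == j)%:R.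
    have /(congr1 (fun M : 'M[R[i]]_n => complex.Re (M i j))) := UU.
    rewrite !mxE raddf_sum => h; transitivity (complex.Re ((i == j)%:R : R[i])).
      rewrite -h; apply: eq_bigr => k _; rewrite !mxE /=.
      by case: (U k i) (U k j) => a b [c e] /=; rewrite mulNr opprK.
    by case: eqP.
  pose F k v := dotv (if v then er k else em k) x * dotv (if v then er k else em k) y.
  rewrite (eq_bigr (fun p => F p.1 p.2)); last by case.
  rewrite -(pair_bigA _ F) /=; apply/esym.
  transitivity (\sum_i \sum_j x i 0 * y j 0 * (i == j)%:R).
    under eq_bigr => k _ do rewrite big_bool /F /= /dotv !big_distrlr /= -big_split /=.
    rewrite exchange_big /=; apply: eq_bigr => i _.
    under eq_bigr => k _ do rewrite -big_split /=.
    rewrite exchange_big /=; apply: eq_bigr => j _.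
    rewrite -frame mulr_sumr; apply: eq_bigr => k _.
    by ring.
  apply: eq_bigr => i _; rewrite (bigD1 i)//= eqxx mulr1 big1 ?addr0// => j.
  by rewrite eq_sym => /negbTE ->; rewrite mulr0.
Qed.

(** * Square integrable functions *)

Notation integ mu f := (mu.-integrable setT (EFin \o f)).

Definition sqint {d} {T : measurableType d} {R : realType}
    (mu : probability T R) (f : T -> R) :=
  measurable_fun setT f /\ integ mu (fun x => f x ^+ 2).

Section SquareIntegrable.
Context {d} {T : measurableType d} {R : realType} (mu : probability T R).
Implicit Types f g : T -> R.
Local Notation E f := (Rintegral mu setT f).

Lemma integD f g : integ mu f -> integ mu g -> integ mu (fun x => f x + g x).
Proof. by move=> fi gi; exact: (integrableD measurableT fi gi). Qed.

Lemma integZ c f : integ mu f -> integ mu (fun x => c * f x).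
Proof. by move=> fi; exact: (integrableZl measurableT c fi). Qed.

Lemma integN f : integ mu f -> integ mu (fun x => - f x).
Proof. by move=> fi; exact: (integrableN fi). Qed.

Lemma integB f g : integ mu f -> integ mu g -> integ mu (fun x => f x - g x).
Proof. by move=> fi gi; apply: integD => //; exact: integN. Qed.

Lemma integ_cst c : integ mu (fun=> c).
Proof. exact: finite_measure_integrable_cst. Qed.

Lemma integ_sum I (s : seq I) (F : I -> T -> R) : (forall i, integ mu (F i)) ->
  integ mu (fun x => \sum_(i <- s) F i x).
Proof.
move=> Fi; elim: s => [|i s IH].
  by under eq_fun do rewrite big_nil; exact: integ_cst.
by under eq_fun do rewrite big_cons; exact: integD.
Qed.

Lemma Rintegral_cstT c : E (fun=> c) = c.
Proof. by rewrite Rintegral_cst//= probability_setT mulr1. Qed.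

Lemma Rintegral_sumT I (s : seq I) (F : I -> T -> R) :
  (forall i, integ mu (F i)) ->
  E (fun x => \sum_(i <- s) F i x) = \sum_(i <- s) E (F i).
Proof.
move=> Fi; elim: s => [|i s IH].
  by under eq_fun do rewrite big_nil; rewrite big_nil Rintegral_cstT.
under eq_fun do rewrite big_cons; rewrite big_cons -IH RintegralD//.
exact: integ_sum.
Qed.

Lemma RintegralN f : integ mu f -> E (fun x => - f x) = - E f.
Proof.
move=> fi; rewrite -mulN1r -RintegralZl//; congr Rintegral.
by apply/funext => x; rewrite mulN1r.
Qed.

Lemma le_integ f g : measurable_fun setT f -> integ mu g ->
  (forall x, `|f x| <= g x) -> integ mu f.
Proof.
move=> mf gi fg; apply: (le_integrable measurableT _ _ gi).
  exact/measurable_EFinP.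
by move=> x _ /=; rewrite lee_fin (le_trans (fg x))// ler_norm.
Qed.

Lemma sqintM f g : sqint mu f -> sqint mu g -> integ mu (fun x => f x * g x).
Proof.
move=> [mf fi] [mg gi]; apply: (le_integ _ (fun x => f x ^+ 2 + g x ^+ 2)).
- exact: measurable_funM.
- exact: integD.
- move=> x; rewrite ler_norml; apply/andP; split; nra.
Qed.

Lemma sqint_cst c : sqint mu (fun=> c).
Proof. by split; [exact: measurable_cst|exact: integ_cst]. Qed.

Lemma sqint_integ f : sqint mu f -> integ mu f.
Proof.
move=> fi; have := sqintM f (fun=> 1) fi (sqint_cst 1).
by under eq_fun do rewrite mulr1.
Qed.

Lemma sqintD f g : sqint mu f -> sqint mu g -> sqint mu (fun x => f x + g x).
Proof.
move=> fi gi; split; first by apply: measurable_funD; [case: fi|case: gi].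
under eq_fun do rewrite sqrrD -mulr_natl.
apply: integD; last by case: gi.
by apply: integD; [case: fi|apply: integZ; exact: sqintM].
Qed.

Lemma sqintZ c f : sqint mu f -> sqint mu (fun x => c * f x).
Proof.
move=> [mf fi]; split; first exact: measurable_funM.
by under eq_fun do rewrite exprMn; exact: integZ.
Qed.

Lemma sqintB f g : sqint mu f -> sqint mu g -> sqint mu (fun x => f x - g x).
Proof.
move=> fi gi; have := sqintD _ _ fi (sqintZ (-1) g gi).
by under eq_fun do rewrite mulN1r.
Qed.

Lemma sqint_sum I (s : seq I) (F : I -> T -> R) : (forall i, sqint mu (F i)) ->
  sqint mu (fun x => \sum_(i <- s) F i x).
Proof.
move=> Fi; elim: s => [|i s IH].
  by under eq_fun do rewrite big_nil; exact: sqint_cst.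
by under eq_fun do rewrite big_cons; exact: sqintD.
Qed.

Lemma integ_ge0P f : measurable_fun setT f -> (forall x, 0 <= f x) ->
  (\int[mu]_x (f x)%:E < +oo)%E -> integ mu f.
Proof.
move=> mf f0 fi; apply/integrableP; split; first exact/measurable_EFinP.
by under eq_integral => x _ do rewrite /= ger0_norm//.
Qed.

Lemma integralE_fin f : integ mu f -> (\int[mu]_x (f x)%:E = (E f)%:E)%E.
Proof. by move=> fi; rewrite fineK//; exact: integrable_fin_num. Qed.

Lemma le_RintegralT f g : integ mu f -> integ mu g -> (forall x, f x <= g x) ->
  E f <= E g.
Proof. by move=> fi gi fg; apply: le_Rintegral. Qed.

End SquareIntegrable.

(** * Linear form of AcSGD *)

Section Process.
Context {R : realType} {n : nat} (al be : R).
Implicit Types (u th : 'cV[R]_n * 'cV[R]_n * 'cV[R]_n) (H : 'M[R]_n).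

Definition lf u th : R :=
  dotv u.1.1 th.1.1 + dotv u.1.2 th.1.2 + dotv u.2 th.2.

Definition acstep th (a : 'cV[R]_n) (c : R) : 'cV[R]_n * 'cV[R]_n * 'cV[R]_n :=
  let G := (dotv a th.1.1 - c) *: a in
  (th.1.1 + th.1.2 - (al + be) *: G, th.1.2 - al *: G, th.2 + th.1.1).

(* State [(s_t, v_t, s_0 + ... + s_(t-1))], where [s_t = (t+1)(x_t - x_star)] and
   [v_t = z_t - x_star]; in these coordinates AcSGD is linear with
   time-independent coefficients. *)
Fixpoint proc (w0 : 'cV[R]_n) (A : nat -> 'cV[R]_n) (B : nat -> R) (t : nat) :=
  match t with
  | 0 => (w0, w0, 0)
  | t'.+1 => acstep (proc w0 A B t') (A t') (t'.+1%:R * B t')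
  end.

(** Transpose of [acstep] with the gradient term removed. *)
Definition shift u : 'cV[R]_n * 'cV[R]_n * 'cV[R]_n :=
  (u.1.1 + u.2, u.1.1 + u.1.2, u.2).

Definition gain u : 'cV[R]_n := (al + be) *: u.1.1 + al *: u.1.2.

(** Transpose of the averaged step, in which [a a^T] is replaced by its mean [H]. *)
Definition adj H u : 'cV[R]_n * 'cV[R]_n * 'cV[R]_n :=
  (u.1.1 + u.2 - H *m gain u, u.1.1 + u.1.2, u.2).

Lemma lf_acstep u th a c :
  lf u (acstep th a c) = lf (shift u) th - dotv (gain u) a * (dotv a th.1.1 - c).
Proof.
rewrite /lf /acstep /shift /gain /= !(dotvDl, dotvDr, dotvNr, dotvNl, dotvZr, dotvZl).
by ring.
Qed.

Lemma lf_adj H u th : lf (adj H u) th = lf (shift u) th - dotv (H *m gain u) th.1.1.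
Proof. by rewrite /lf /adj /shift /= !(dotvDl, dotvNl); ring. Qed.

Lemma dotv_delta i (v : 'cV[R]_n) : dotv (delta_mx i 0) v = v i 0.
Proof.
rewrite /dotv (bigD1 i)//= mxE !eqxx mul1r big1 ?addr0// => j /negbTE ji.
by rewrite mxE ji mul0r.
Qed.

Lemma lf_x p th : lf (p, 0, 0) th = dotv p th.1.1.
Proof. by rewrite /lf /= !dotv0l !addr0. Qed.

(** The source space and the maps [g j], [j < t], are left general because the lemma is applied both
    on [Omega] and on the coarser space [past xi t]. *)
Lemma measurable_proc {d} {Y : measurableType d} {dX} {X : measurableType dX}
    (a : X -> 'cV[R]_n) (e : X -> R) (g : nat -> Y -> X) w0 t u :
  (forall p, measurable_fun setT (fun z => dotv p (a z))) ->
  measurable_fun setT e ->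
  (forall j, (j < t)%N -> measurable_fun setT (g j)) ->
  measurable_fun setT
    (fun y => lf u (proc w0 (fun j => a (g j y)) (fun j => e (g j y)) t)).
Proof.
move=> ma me; elim: t u => [|t IH] u mg.
  exact: (measurable_cst (lf u (w0, w0, 0))).
have {}IH v := IH v (fun j jt => mg j (leq_trans jt (leqnSn t))).
have mag p : measurable_fun setT (fun y => dotv p (a (g t y))).
  by apply: (measurableT_comp (ma p)); exact: mg.
under eq_fun do rewrite /= lf_acstep.
apply: measurable_funB; first exact: IH.
apply: measurable_funM; first exact: mag.
apply: measurable_funB; last first.
  by apply: measurable_funM => //; apply: (measurableT_comp me); exact: mg.
rewrite /dotv; apply: measurable_sum => i; apply: measurable_funM.
  by under eq_fun do rewrite -dotv_delta; exact: mag.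
by under eq_fun do rewrite -dotv_delta -lf_x; exact: IH.
Qed.

(** Superposition for fixed features: this is what separates bias from variance. *)
Lemma procD w1 w2 A B1 B2 t u :
  lf u (proc (w1 + w2) A (fun j => B1 j + B2 j) t) =
  lf u (proc w1 A B1 t) + lf u (proc w2 A B2 t).
Proof.
elim: t u => [|t IH] u /=; first by rewrite /lf /= !dotvDr dotv0r; ring.
by rewrite !lf_acstep IH -!lf_x IH; ring.
Qed.

End Process.

(** * Adjoint recursion along an eigenvector *)

Section ScalarRecursion.
Context {R : realFieldType} (al be l : R).
Hypotheses (al0 : 0 < al) (be0 : 0 < be) (l0 : 0 < l).
Hypotheses (step_le : (al + 2 * be) * l <= 1) (al_be : 2 * al <= be).

Let step_bounds : [/\ 0 < al * l, 0 < be * l, 2 * (al * l) <= be * l,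
  al * l <= 1 / 5 & be * l <= 1 / 2].
Proof.
have a0 : 0 < al * l by exact: mulr_gt0.
have b0 : 0 < be * l by exact: mulr_gt0.
have ab : 2 * (al * l) <= be * l by rewrite mulrA ler_pM2r.
have abl : al * l + 2 * (be * l) <= 1 by move: step_le; rewrite mulrDl -mulrA.
by split=> //; lra.
Qed.

Let damping : (1 - be * l) ^+ 2 <= 1 - al * l.
Proof.
have [] := step_bounds; move: (al * l) (be * l) => x y x0 y0 xy x5 y2; nra.
Qed.

Definition sgain (p q : R) := (al + be) * p + al * q.

(* Solution, up to the factor [(4 - (al + 2 be) l) / 3 >= 1], of the Lyapunov
   equation [W(p, q) - W(p - l r, p + q) = l r^2] with [r = sgain p q]. *)
Definition lyap (p q : R) := (3 * be)^-1 * (2 * sgain p q ^+ 2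
  - 2 * al * sgain p q * p + (2 - be * l) * al * p ^+ 2 / l).

(** Since [al l <= 1 <= 2 - be l], the last term dominates [al^2 p^2]; the bracket is then at least
    [r^2 + (r - al p)^2] with [r = sgain p q]. *)
Lemma lyap_ge0 p q : 0 <= lyap p q.
Proof.
have [a0 b0 ab al_l be_l] := step_bounds.
rewrite /lyap; apply: mulr_ge0; first by rewrite invr_ge0 mulr_ge0// ltW.
set r := sgain p q.
have h : al ^+ 2 * p ^+ 2 <= (2 - be * l) * al * p ^+ 2 / l.
  rewrite ler_pdivlMr//.
  have -> : al ^+ 2 * p ^+ 2 * l = (al * p ^+ 2) * (al * l) by ring.
  have -> : (2 - be * l) * al * p ^+ 2 = (al * p ^+ 2) * (2 - be * l) by ring.
  apply: ler_wpM2l; first by rewrite mulr_ge0 ?sqr_ge0// ltW.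
  by rewrite lerBrDr; lra.
have := sqr_ge0 (r - al * p); have := sqr_ge0 r; nra.
Qed.

Lemma lyap_step p q :
  lyap (p - l * sgain p q) (p + q) + l * sgain p q ^+ 2 <= lyap p q.
Proof.
have [a0 b0 ab al_l be_l] := step_bounds.
(* Exact identity; its coefficient is at least 1 because [(al + 2 be) l <= 1]. *)
have -> : lyap p q = lyap (p - l * sgain p q) (p + q) +
    (4 - (al + 2 * be) * l) / 3 * (l * sgain p q ^+ 2).
  by rewrite /lyap /sgain; field; rewrite !gt_eqF.
rewrite lerD2l ler_peMl//; first by rewrite mulr_ge0 ?sqr_ge0// ltW.
by move: step_le; lra.
Qed.

Lemma lyap_p0 p : lyap p 0 = (2 / 3 * (al / (be * l)) + (al + 2 * be) / 3) * p ^+ 2.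
Proof. by rewrite /lyap /sgain; field; rewrite !gt_eqF. Qed.

Fixpoint adjpq (j : nat) : R * R :=
  match j with
  | 0 => (1, 0)
  | j'.+1 => let: (p, q) := adjpq j' in (p - l * sgain p q, p + q)
  end.

Lemma sum_sgain_le m :
  \sum_(j < m) l * sgain (adjpq j).1 (adjpq j).2 ^+ 2 <=
  2 / 3 * (al / (be * l)) + (al + 2 * be) / 3.
Proof.
have -> : 2 / 3 * (al / (be * l)) + (al + 2 * be) / 3 = lyap 1 0.
  by rewrite lyap_p0 expr1n mulr1.
suff : \sum_(j < m) l * sgain (adjpq j).1 (adjpq j).2 ^+ 2
    + lyap (adjpq m).1 (adjpq m).2 <= lyap 1 0.
  by apply: le_trans; rewrite lerDl lyap_ge0.
elim: m => [|m IH]; first by rewrite big_ord0 add0r.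
apply: le_trans IH; rewrite big_ord_recr /= -addrA lerD2l addrC.
by case: (adjpq m) => p q /=; exact: lyap_step.
Qed.

(** The energy [(1 - al l) p^2 + al l (p + q)^2] starts at 1 and does not increase, by [damping]. *)
Lemma adjpq_al j : al * (l * ((adjpq j).1 + (adjpq j).2) ^+ 2) <= 1.
Proof.
have [a0 b0 ab al_l be_l] := step_bounds.
suff : (1 - al * l) * (adjpq j).1 ^+ 2
    + al * l * ((adjpq j).1 + (adjpq j).2) ^+ 2 <= 1.
  apply: le_trans; rewrite mulrA lerDr mulr_ge0 ?sqr_ge0//; nra.
elim: j => [|j IH] /=; first by rewrite addr0 expr1n; lra.
apply: le_trans IH; case: (adjpq j) => p q /=.
have -> : (1 - al * l) * (p - l * sgain p q) ^+ 2
    + al * l * (p - l * sgain p q + (p + q)) ^+ 2 =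
    (1 - be * l) ^+ 2 * p ^+ 2 + (1 - al * l) * (al * l * (p + q) ^+ 2).
  by rewrite /sgain; ring.
have : (1 - be * l) ^+ 2 * p ^+ 2 <= (1 - al * l) * p ^+ 2.
  by apply: ler_wpM2r; [exact: sqr_ge0|exact: damping].
have : (1 - al * l) * (al * l * (p + q) ^+ 2) <= al * l * (p + q) ^+ 2.
  by apply: ler_piMl; [exact: mulr_ge0 (ltW a0) (sqr_ge0 _)|lra].
lra.
Qed.

(** In the variables [y = p + q] and a velocity [v], the orbit reads [v' = v - al l y],
    [y' = (1 - be l) y + v']. An energy keeps [v^2 <= 1], and [be l y^2] grows by at most [v'^2] per
    step. *)
Lemma adjpq_be j : be * (l * ((adjpq j).1 + (adjpq j).2) ^+ 2) <= j.+1%:R.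
Proof.
have [a0 b0 ab al_l be_l] := step_bounds.
pose y j := (adjpq j).1 + (adjpq j).2.
pose v j := be * l * y j + (1 - be * l) * (adjpq j).1.
rewrite -/(y j).
have vS i : v i.+1 = v i - al * l * y i.
  by rewrite /v /y /=; case: (adjpq i) => p q /=; rewrite /sgain; ring.
have yS i : y i.+1 = (1 - be * l) * y i + v i.+1.
  by rewrite vS /v /y /=; case: (adjpq i) => p q /=; rewrite /sgain; ring.
have F i : v i ^+ 2 + al * l * (y i - v i) ^+ 2 <= 1.
  elim: i => [|i IH]; first by rewrite /v /y /=; nra.
  apply: le_trans IH; rewrite yS addrK vS.
  have -> : (v i - al * l * y i) ^+ 2 + al * l * ((1 - be * l) * y i) ^+ 2 =
    v i ^+ 2 + al * l * (y i - v i) ^+ 2 - al * l * v i ^+ 2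
    - al * l * y i ^+ 2 * (1 - al * l - (1 - be * l) ^+ 2) by ring.
  have : 0 <= al * l * v i ^+ 2 by rewrite mulr_ge0 ?sqr_ge0// ltW.
  have : 0 <= al * l * y i ^+ 2 * (1 - al * l - (1 - be * l) ^+ 2).
    by apply: mulr_ge0; [rewrite mulr_ge0 ?sqr_ge0// ltW|rewrite subr_ge0 damping].
  lra.
have v1 i : v i ^+ 2 <= 1.
  by apply: le_trans (F i); rewrite lerDl mulr_ge0 ?sqr_ge0// ltW.
elim: j => [|j IH]; first by rewrite /y /= addr0 expr1n; nra.
rewrite -natr1; apply: (le_trans _ (lerD IH (v1 j.+1))).
rewrite yS; set Y := y j; set V := v j.+1; set b := be * l.
(* The gap between the two sides of the one-step bound, written as a sum of nonnegative terms. *)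
have -> : be * (l * Y ^+ 2) + V ^+ 2 = be * (l * ((1 - b) * Y + V) ^+ 2)
    + (1 - b) * (b * Y - V) ^+ 2 + b ^+ 2 * Y ^+ 2 by rewrite /b; ring.
rewrite -addrA lerDl addr_ge0// mulr_ge0 ?sqr_ge0//; rewrite /b; lra.
Qed.

(* [(p, q)] is the adjoint orbit with unit source; the components [l al (p + q)]
   and [be l p] of [l r] are bounded separately, as no single quadratic form
   controls both uniformly in [l]. *)
Definition source_inv (p q : R) :=
  al * l * (1 - al * l) * p ^+ 2 + (l * al * (p + q) - 1) ^+ 2 <= 1 /\
  -1 <= be * l * p <= 1.

Lemma source_inv0 : source_inv 0 0.
Proof. by rewrite /source_inv addr0 !mulr0 expr0n /= mulr0; split; lra. Qed.

Lemma source_inv_g p q : source_inv p q -> -1 <= l * al * (p + q) - 1 <= 1.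
Proof.
have [a0 b0 ab al_l be_l] := step_bounds.
move=> [h _]; set g := _ - 1; have : g ^+ 2 <= 1.
  apply: le_trans h; rewrite lerDr mulr_ge0 ?sqr_ge0// mulr_ge0; lra.
by move: g => g g2; apply/andP; split; nra.
Qed.

Lemma source_inv_step p q :
  source_inv p q -> source_inv (p - l * sgain p q + 1) (p + q).
Proof.
have [a0 b0 ab al_l be_l] := step_bounds.
move=> pq; have := source_inv_g _ _ pq; move: pq => [h1 h2].
set g := l * al * (p + q) - 1 => gP; rewrite -/g in h1.
have -> : p - l * sgain p q + 1 = (1 - be * l) * p - g.
  by rewrite /g /sgain; ring.
split; last first.
  (* A convex combination, with weight [be l], of [be l p] and [- g], both in [[-1, 1]]. *)
  have -> : be * l * ((1 - be * l) * p - g) = (1 - be * l) * (be * l * p) - be * l * g.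
    by ring.
  move/andP: h2 => [h2 h3]; move/andP: gP => [g1 g2]; apply/andP; split; nra.
apply: le_trans h1.
have -> : al * l * (1 - al * l) * ((1 - be * l) * p - g) ^+ 2
    + (l * al * ((1 - be * l) * p - g + (p + q)) - 1) ^+ 2 =
    (1 - be * l) ^+ 2 * (al * l * p ^+ 2) + (1 - al * l) * g ^+ 2.
  by rewrite /g; ring.
have -> : al * l * (1 - al * l) * p ^+ 2 = (1 - al * l) * (al * l * p ^+ 2) by ring.
apply: lerD.
  by apply: ler_wpM2r; [rewrite mulr_ge0 ?sqr_ge0// ltW|exact: damping].
by rewrite ler_piMl ?sqr_ge0//; lra.
Qed.

(** [l r] is a sum of three terms of absolute value at most 1, hence [(l r)^2 <= 9]. *)
Lemma source_inv_sgain p q : source_inv p q -> l * sgain p q ^+ 2 <= 9 / l.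
Proof.
move=> pq; have /andP[g1 g2] := source_inv_g _ _ pq; have [_ /andP[b1 b2]] := pq.
rewrite ler_pdivlMr//.
have -> : l * sgain p q ^+ 2 * l = (be * l * p + (l * al * (p + q) - 1) + 1) ^+ 2.
  by rewrite /sgain; ring.
move: (be * l * p) (_ - 1) b1 b2 g1 g2 => x y x1 x2 y1 y2; nra.
Qed.

End ScalarRecursion.
Lemma sqr_sum_le {R : realFieldType} m (x : 'I_m -> R) :
  (\sum_i x i) ^+ 2 <= m%:R * \sum_i x i ^+ 2.
Proof.
elim: m x => [|[|m] IH] x; first by rewrite !big_ord0 expr0n mulr0.
  by rewrite !big_ord1 mul1r.
rewrite !(big_ord_recr m.+1) /=; set S := \sum_i _; set Q := \sum_i _.
set y := x ord_max; have SQ : S ^+ 2 <= m.+1%:R * Q by exact: IH.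
have mR : 0 < m.+1%:R :> R by rewrite ltr0n.
rewrite -(ler_pM2l mR) -(natr1 m.+1); have := sqr_ge0 (S - m.+1%:R * y).
move: (m.+1%:R) mR SQ => c c0 SQ h; nra.
Qed.

(** * Second moments of the iterates *)

Section Moments.
Context {R : realType} {n : nat} {dX} {X : measurableType dX}
  (rho : probability X R) (a : X -> 'cV[R]_n) (e : X -> R) (H : 'M[R]_n)
  {dT} {Omega : measurableType dT} (P : probability Omega R)
  (xi : nat -> Omega -> X) (al be : R) (w0 : 'cV[R]_n).
Local Notation ER f := (Rintegral rho setT f).
Local Notation EP f := (Rintegral P setT f).
Hypothesis xiP : iid_with_law P rho xi.
Hypothesis sa : forall p, sqint rho (fun z => dotv p (a z)).
Hypothesis se : sqint rho e.
Hypothesis saa : forall p q, sqint rho (fun z => dotv p (a z) * dotv q (a z)).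
Hypothesis sea : forall p, sqint rho (fun z => e z * dotv p (a z)).
Hypothesis Eaa : forall p q,
  ER (fun z => dotv p (a z) * dotv q (a z)) = dotv p (H *m q).
Hypothesis Eea : forall p, ER (fun z => e z * dotv p (a z)) = 0.
Hypothesis Hsym : H^T = H.

Definition quart r y : R := ER (fun z => (dotv r (a z) * dotv y (a z)) ^+ 2).
Definition cross r y : R :=
  ER (fun z => dotv r (a z) * dotv y (a z) * (e z * dotv r (a z))).
Definition noise r : R := ER (fun z => (e z * dotv r (a z)) ^+ 2).

Definition thstate t w :=
  proc al be w0 (fun j => a (xi j w)) (fun j => e (xi j w)) t.

(** One step with the past frozen: [x] is the drifted value of the functional, [r] its gain, [y] the
    current [s_t] and [tau] stands for [t + 1]. The term linear in [e] vanishes by [Eea]; [cross]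
    remains, since features and label noise may be dependent. *)
Lemma sample_sq x tau r y :
  integ rho (fun z => (x - dotv r (a z) * (dotv (a z) y - tau * e z)) ^+ 2) /\
  ER (fun z => (x - dotv r (a z) * (dotv (a z) y - tau * e z)) ^+ 2) =
  x ^+ 2 - 2 * x * dotv r (H *m y) + quart r y - 2 * tau * cross r y
  + tau ^+ 2 * noise r.
Proof.
pose Y z := dotv r (a z) * dotv y (a z); pose Z z := e z * dotv r (a z).
have sY : sqint rho Y by exact: saa.
have sZ : sqint rho Z by exact: sea.
have -> : (fun z => (x - dotv r (a z) * (dotv (a z) y - tau * e z)) ^+ 2) =
    (fun z => x ^+ 2 + (- 2 * x) * Y z + (2 * x * tau) * Z z + Y z ^+ 2
              + (- 2 * tau) * (Y z * Z z) + tau ^+ 2 * Z z ^+ 2).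
  by apply/funext => z; rewrite /Y /Z (dotvC (a z)); ring.
have iY := sqint_integ _ _ sY; have iZ := sqint_integ _ _ sZ.
have iYZ := sqintM _ _ _ sY sZ; have [_ iY2] := sY; have [_ iZ2] := sZ.
have j1 := integZ _ (- 2 * x) _ iY; have j2 := integZ _ (2 * x * tau) _ iZ.
have j3 := integZ _ (- 2 * tau) _ iYZ; have j4 := integZ _ (tau ^+ 2) _ iZ2.
have k1 := integD _ _ _ (integ_cst rho (x ^+ 2)) j1.
have k2 := integD _ _ _ k1 j2; have k3 := integD _ _ _ k2 iY2.
have k4 := integD _ _ _ k3 j3; split; first exact: (integD _ _ _ k4 j4).
rewrite (RintegralD _ k4 j4)// (RintegralD _ k3 j3)// (RintegralD _ k2 iY2)//.
rewrite (RintegralD _ k1 j2)// (RintegralD _ (integ_cst rho _) j1)//.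
rewrite Rintegral_cstT !RintegralZl// Eaa Eea.
by rewrite /quart /cross /noise -/Y -/Z; ring.
Qed.

Definition quart_coef r i j : R :=
  ER (fun z => dotv r (a z) * a z i 0 * (dotv r (a z) * a z j 0)).

(** As a quadratic polynomial in [y] with deterministic coefficients, [quart r] becomes integrable
    along the iterates as soon as their coordinates are square integrable. [crossE] is the linear
    analogue. *)
Lemma quartE r y :
  quart r y = \sum_i \sum_j quart_coef r i j * (y i 0 * y j 0).
Proof.
have sra i : sqint rho (fun z => dotv r (a z) * a z i 0).
  by under eq_fun do rewrite -(dotv_delta i); exact: saa.
have -> : quart r y = ER (fun z => \sum_i \sum_j y i 0 * y j 0 *
    (dotv r (a z) * a z i 0 * (dotv r (a z) * a z j 0))).
  congr Rintegral; apply/funext => z; rewrite [dotv y _]/dotv.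
  rewrite mulr_sumr expr2 big_distrlr /=.
  by apply: eq_bigr => i _; apply: eq_bigr => j _; ring.
rewrite Rintegral_sumT; last first.
  by move=> i; apply: integ_sum => j; apply: integZ; exact: sqintM.
apply: eq_bigr => i _; rewrite Rintegral_sumT; last first.
  by move=> j; apply: integZ; exact: sqintM.
apply: eq_bigr => j _.
  rewrite RintegralZl; [by rewrite [RHS]mulrC|by []|exact: sqintM].
Qed.

Lemma crossE r y : cross r y =
  \sum_i ER (fun z => dotv r (a z) * a z i 0 * (e z * dotv r (a z))) * y i 0.
Proof.
have sra i : sqint rho (fun z => dotv r (a z) * a z i 0).
  by under eq_fun do rewrite -(dotv_delta i); exact: saa.
have -> : cross r y = ER (fun z => \sum_i y i 0 *
    (dotv r (a z) * a z i 0 * (e z * dotv r (a z)))).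
  congr Rintegral; apply/funext => z; rewrite [dotv y _]/dotv.
  by rewrite mulr_sumr mulr_suml; apply: eq_bigr => i _; ring.
rewrite Rintegral_sumT; last by move=> i; apply: integZ; exact: sqintM.
apply: eq_bigr => i _.
  rewrite RintegralZl; [by rewrite [RHS]mulrC|by []|exact: sqintM].
Qed.

Lemma measurable_thstate t u : measurable_fun setT (fun w => lf u (thstate t w)).
Proof.
apply: measurable_proc; last by move=> j _; exact: (measurable_sample P rho).
  by move=> p; case: (sa p).
by case: se.
Qed.

(* Conditioning on the past: the sample [t] is integrated against [rho] first. *)
Lemma integral_thstateS t u c :
  (\int[P]_w ((lf u (thstate t.+1 w) + c) ^+ 2)%:E =
   \int[P]_w (ER (fun z => (lf (shift u) (thstate t w) + c
      - dotv (gain al be u) (a z) *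
        (dotv (a z) (thstate t w).1.1 - t.+1%:R * e z)) ^+ 2))%:E)%E.
Proof.
(* The same process as [thstate t], now seen as a function on the past. *)
pose pth (y : past xi t) :=
  proc al be w0 (fun j => a (xi j y)) (fun j => e (xi j y)) t.
have mpth v : measurable_fun setT (fun y : past xi t => lf v (pth y)).
  apply: measurable_proc.
  - by move=> p; case: (sa p).
  - by case: se.
  - by move=> j jt; exact: measurable_sample_past.
pose f (yz : (past xi t * X)%type) : \bar R :=
  ((lf (shift u) (pth yz.1) + c - dotv (gain al be u) (a yz.2) *
     (dotv (a yz.2) (pth yz.1).1.1 - t.+1%:R * e yz.2)) ^+ 2)%:E.
have mf : measurable_fun setT f.
  apply/measurable_EFinP; apply: measurable_funX.
  have m1 v : measurable_fun setT (fun yz : (past xi t * X)%type => lf v (pth yz.1)).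
    exact: (measurableT_comp (mpth v) measurable_fst).
  have m2 p : measurable_fun setT (fun yz : (past xi t * X)%type => dotv p (a yz.2)).
    by case: (sa p) => ma _; exact: (measurableT_comp ma measurable_snd).
  apply: measurable_funB; first by apply: measurable_funD.
  apply: measurable_funM => //; apply: measurable_funB; last first.
    apply: measurable_funM => //.
    by case: se => me _; exact: (measurableT_comp me measurable_snd).
  rewrite /dotv; apply: measurable_sum => i; apply: measurable_funM.
    by under eq_fun do rewrite -dotv_delta; exact: m2.
  by under eq_fun do rewrite -dotv_delta -lf_x; exact: m1.
have f0 yz : (0 <= f yz)%E by rewrite lee_fin sqr_ge0.
have := integral_indep P rho xi xiP t f mf f0.
rewrite /f /= => h; transitivity (\int[P]_w f (w, xi t w))%E.
  apply: eq_integral => w _; rewrite /f /= lf_acstep; congr (_ ^+ 2)%:E.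
  by rewrite /pth /thstate; ring.
rewrite /f h; apply: eq_integral => w _.
rewrite integralE_fin//.
by have [] := sample_sq (lf (shift u) (pth w) + c) t.+1%:R (gain al be u) (pth w).1.1.
Qed.

Lemma sqint_coord t i : (forall v, sqint P (fun w => lf v (thstate t w))) ->
  sqint P (fun w => (thstate t w).1.1 i 0).
Proof. by move=> IH; under eq_fun do rewrite -dotv_delta -lf_x; exact: IH. Qed.

Lemma integ_quart t r : (forall v, sqint P (fun w => lf v (thstate t w))) ->
  integ P (fun w => quart r (thstate t w).1.1).
Proof.
move=> IH; under eq_fun do rewrite quartE.
apply: integ_sum => i; apply: integ_sum => j; apply: integZ.
by apply: sqintM; exact: sqint_coord.
Qed.

Lemma integ_cross t r : (forall v, sqint P (fun w => lf v (thstate t w))) ->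
  integ P (fun w => cross r (thstate t w).1.1).
Proof.
move=> IH; under eq_fun do rewrite crossE.
by apply: integ_sum => i; apply: integZ; apply: sqint_integ; exact: sqint_coord.
Qed.

(** Complete the square in [sample_sq]: with [x = lf (shift u) + c], the quantity [x - <r, H s_t>]
    is [lf (adj u) + c]. The constant [c] serves to recover first moments from second ones. *)
Lemma moment_step t u c :
  (forall v, sqint P (fun w => lf v (thstate t w))) ->
  integ P (fun w => (lf u (thstate t.+1 w) + c) ^+ 2) /\
  EP (fun w => (lf u (thstate t.+1 w) + c) ^+ 2) =
  EP (fun w => (lf (adj al be H u) (thstate t w) + c) ^+ 2)
  - EP (fun w => dotv (H *m gain al be u) (thstate t w).1.1 ^+ 2)
  + EP (fun w => quart (gain al be u) (thstate t w).1.1)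
  - 2 * t.+1%:R * EP (fun w => cross (gain al be u) (thstate t w).1.1)
  + t.+1%:R ^+ 2 * noise (gain al be u).
Proof.
move=> IH; set r := gain al be u; set tau : R := t.+1%:R.
pose g w := (lf (adj al be H u) (thstate t w) + c) ^+ 2
  + - dotv (H *m r) (thstate t w).1.1 ^+ 2
  + quart r (thstate t w).1.1 + (- 2 * tau) * cross r (thstate t w).1.1
  + tau ^+ 2 * noise r.
have [_ i1] := sqintD _ _ _ (IH (adj al be H u)) (sqint_cst P c).
have [_ i2] : sqint P (fun w => dotv (H *m r) (thstate t w).1.1).
  by under eq_fun do rewrite -lf_x; exact: IH.
have {}i2 := integN _ _ i2.
have i3 := integ_quart t r IH.
have i4 := integZ _ (- 2 * tau) _ (integ_cross t r IH).
have j1 := integD _ _ _ i1 i2; have j2 := integD _ _ _ j1 i3.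
have j3 := integD _ _ _ j2 i4.
have ig : integ P g := integD _ _ _ j3 (integ_cst P _).
(* Computed in the extended reals first: the finite value is what proves integrability at time
   [t + 1]. *)
have gE : (\int[P]_w ((lf u (thstate t.+1 w) + c) ^+ 2)%:E = (EP g)%:E)%E.
  rewrite integral_thstateS -integralE_fin//; apply: eq_integral => w _.
  have [_ ->] := sample_sq (lf (shift u) (thstate t w) + c) tau r (thstate t w).1.1.
  congr _%:E; rewrite /g lf_adj -/r -[in dotv r _]Hsym -dotv_mulmx_tr; ring.
have ith : integ P (fun w => (lf u (thstate t.+1 w) + c) ^+ 2).
  apply: integ_ge0P => [|w|]; [|exact: sqr_ge0|by rewrite gE ltry].
  apply: measurable_funX; apply: measurable_funD => //.
  exact: measurable_thstate.
split=> //; have := gE; rewrite integralE_fin// => -[->].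
rewrite /g (RintegralD _ j3 (integ_cst P _))// (RintegralD _ j2 i4)//.
rewrite (RintegralD _ j1 i3)// (RintegralD _ i1 i2)// Rintegral_cstT.
rewrite RintegralZl//; last exact: integ_cross.
rewrite RintegralN//; last by have := integN _ _ i2; under eq_fun do rewrite opprK.
by move: (EP _) (EP _) (EP _) (EP _) => *; ring.
Qed.

Lemma sqint_thstate t u : sqint P (fun w => lf u (thstate t w)).
Proof.
elim: t u => [|t IH] u; first exact: (sqint_cst P (lf u (w0, w0, 0))).
split; first exact: measurable_thstate.
by have [] := moment_step t u 0 IH; under eq_fun do rewrite addr0.
Qed.

(** Subtract the case [c = 0] of [moment_step] from the case [c = 1]. *)
Lemma mean_step t u : EP (fun w => lf u (thstate t.+1 w)) =
  EP (fun w => lf (adj al be H u) (thstate t w)).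
Proof.
have sq1 s v : EP (fun w => (lf v (thstate s w) + 1) ^+ 2) =
    EP (fun w => lf v (thstate s w) ^+ 2) + 2 * EP (fun w => lf v (thstate s w)) + 1.
  have [_ i2] := sqint_thstate s v.
  have i1 := integZ _ 2 _ (sqint_integ _ _ (sqint_thstate s v)).
  have -> : (fun w => (lf v (thstate s w) + 1) ^+ 2) =
      (fun w => lf v (thstate s w) ^+ 2 + 2 * lf v (thstate s w) + 1).
    by apply/funext => w; ring.
  rewrite (RintegralD _ (integD _ _ _ i2 i1) (integ_cst P _))//.
  rewrite (RintegralD _ i2 i1)// RintegralZl ?Rintegral_cstT//.
  exact/sqint_integ/sqint_thstate.
have [_] := moment_step t u 1 (sqint_thstate t).
have [_] := moment_step t u 0 (sqint_thstate t).
rewrite !sq1; under [X in X = _ -> _]eq_Rintegral do rewrite addr0.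
under [X in _ = X - _ + _ - _ + _ -> _]eq_Rintegral do rewrite addr0.
by move: (EP _) (EP _) (EP _) (EP _) (EP _) (EP _) => * ; lra.
Qed.

Lemma mean0 t u : w0 = 0 -> EP (fun w => lf u (thstate t w)) = 0.
Proof.
move=> w00; elim: t u => [|t IH] u; last by rewrite mean_step.
rewrite /thstate /= w00 -[RHS](Rintegral_cstT P); congr Rintegral.
by apply/funext => w; rewrite /lf /= !dotv0r !addr0.
Qed.

(** The term [- E <H r, s_t>^2] is dropped. The cross term is linear in [s_t]: it vanishes with the
    mean of [s_t] for a zero start, and trivially without label noise. *)
Lemma second_moment_step t u : w0 = 0 \/ (forall z, e z = 0) ->
  EP (fun w => lf u (thstate t.+1 w) ^+ 2) <=
  EP (fun w => lf (adj al be H u) (thstate t w) ^+ 2)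
  + EP (fun w => quart (gain al be u) (thstate t w).1.1)
  + t.+1%:R ^+ 2 * noise (gain al be u).
Proof.
move=> w0e; set r := gain al be u.
have cross0 : EP (fun w => cross r (thstate t w).1.1) = 0.
  have [w00|e0] := w0e; last first.
    rewrite -[RHS](Rintegral_cstT P); congr Rintegral; apply/funext => w.
    rewrite /cross -[RHS](Rintegral_cstT rho); congr Rintegral.
    by apply/funext => z; rewrite e0; ring.
  under eq_Rintegral do rewrite crossE.
  have si i := sqint_integ _ _ (sqint_coord t i (sqint_thstate t)).
  rewrite Rintegral_sumT => [|i]; last exact: integZ.
  rewrite big1// => i _; rewrite RintegralZl//.
  have -> : EP (fun w => (thstate t w).1.1 i 0) = 0.
    by under eq_Rintegral do rewrite -dotv_delta -lf_x; exact: mean0.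
  by rewrite mulr0.
have [_] := moment_step t u 0 (sqint_thstate t).
under eq_Rintegral do rewrite addr0.
rewrite -/r cross0 => ->; under eq_Rintegral do rewrite addr0.
have : 0 <= EP (fun w => dotv (H *m r) (thstate t w).1.1 ^+ 2).
  by apply: Rintegral_ge0 => w _; exact: sqr_ge0.
by move: (EP _) (EP _) (EP _) => *; lra.
Qed.

(* Tonelli: [E_P quart r s_t = E_rho (<r,a>^2 E_P <a,s_t>^2)]. *)
Lemma quart_le t r (V : 'cV[R]_n -> R) :
  integ rho (fun z => dotv r (a z) ^+ 2 * V (a z)) ->
  (forall p, EP (fun w => dotv p (thstate t w).1.1 ^+ 2) <= V p) ->
  EP (fun w => quart r (thstate t w).1.1) <=
  ER (fun z => dotv r (a z) ^+ 2 * V (a z)).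
Proof.
move=> iV leV; pose S i j := EP (fun w => (thstate t w).1.1 i 0 * (thstate t w).1.1 j 0).
have sc i := sqint_coord t i (sqint_thstate t).
have sra i : sqint rho (fun z => dotv r (a z) * a z i 0).
  by under eq_fun do rewrite -(dotv_delta i); exact: saa.
have sS p : EP (fun w => dotv p (thstate t w).1.1 ^+ 2) =
    \sum_i \sum_j (p i 0 * p j 0) * S i j.
  have -> : (fun w => dotv p (thstate t w).1.1 ^+ 2) = (fun w => \sum_i \sum_j
      (p i 0 * p j 0) * ((thstate t w).1.1 i 0 * (thstate t w).1.1 j 0)).
    apply/funext => w; rewrite /dotv expr2 big_distrlr /=.
    by apply: eq_bigr => i _; apply: eq_bigr => j _; ring.
  rewrite Rintegral_sumT => [|i]; last first.
    by apply: integ_sum => j; apply: integZ; exact: sqintM.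
  apply: eq_bigr => i _; rewrite Rintegral_sumT => [|j]; last first.
    by apply: integZ; exact: sqintM.
  by apply: eq_bigr => j _; rewrite RintegralZl//; exact: sqintM.
pose c z i j := dotv r (a z) * a z i 0 * (dotv r (a z) * a z j 0).
have ic i j : integ rho (fun z => S i j * c z i j) by apply: integZ; exact: sqintM.
have -> : EP (fun w => quart r (thstate t w).1.1) =
    ER (fun z => \sum_i \sum_j S i j * c z i j).
  under eq_Rintegral do rewrite quartE.
  have iq i j : integ P (fun w => quart_coef r i j *
      ((thstate t w).1.1 i 0 * (thstate t w).1.1 j 0)).
    by apply: integZ; exact: sqintM.
  rewrite !Rintegral_sumT => [|i|i]; try exact: integ_sum.
  apply: eq_bigr => i _; rewrite !Rintegral_sumT//.
  apply: eq_bigr => j _; rewrite !RintegralZl//; try exact: sqintM.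
  by rewrite mulrC.
apply: le_RintegralT => // [|z]; first by do 2![apply: integ_sum => ?].
have -> : \sum_i \sum_j S i j * c z i j =
    dotv r (a z) ^+ 2 * EP (fun w => dotv (a z) (thstate t w).1.1 ^+ 2).
  rewrite sS mulr_sumr; apply: eq_bigr => i _.
  by rewrite mulr_sumr; apply: eq_bigr => j _; rewrite /c; ring.
by apply: ler_wpM2l => //; exact: sqr_ge0.
Qed.

(** * Second moments along an eigenframe of the covariance *)

Section EigenBounds.
Context {I : finType} (ev : I -> 'cV[R]_n) (lam : I -> R) (sg2 : R).
Hypothesis Hev : forall k, H *m ev k = lam k *: ev k.
Hypothesis frame : forall x y : 'cV[R]_n,
  dotv x y = \sum_k dotv (ev k) x * dotv (ev k) y.
Hypothesis lam0 : forall k, 0 < lam k.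
Hypotheses (al0 : 0 < al) (be0 : 0 < be) (al_be : I -> 2 * al <= be).
Hypothesis step_le : forall k, (al + 2 * be) * lam k <= 1.
Hypothesis sg2_ge0 : 0 <= sg2.

(** The value of [lyap] at [(1, 0)] for the eigenvalue [lam k]: a bound on the weighted squared
    gains along the whole adjoint orbit. *)
Definition wt k : R := 2 / 3 * (al / (be * lam k)) + (al + 2 * be) / 3.

Hypothesis quart_wt : forall y,
  \sum_k wt k * quart (ev k) y <= 2 / 3 * dotv y (H *m y).
Hypothesis noise_le : forall r, noise r <= sg2 * dotv r (H *m r).

Local Notation c t u := (EP (fun w => lf u (thstate t w) ^+ 2)).

Lemma ev_mulmx k y : dotv (ev k) (H *m y) = lam k * dotv (ev k) y.
Proof. by rewrite -[in LHS]Hsym -dotv_mulmx_tr Hev dotvZl. Qed.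

Lemma dotvHE y : dotv y (H *m y) = \sum_k lam k * dotv (ev k) y ^+ 2.
Proof. by rewrite frame; apply: eq_bigr => k _; rewrite ev_mulmx; ring. Qed.

Lemma gain_ev k p q m :
  gain al be (p *: ev k, q *: ev k, m) = sgain al be p q *: ev k.
Proof. by rewrite /gain /sgain /= !scalerA -scalerDl. Qed.

(** The adjoint preserves multiples of one eigenvector, which reduces it to the scalar recursion
    with source [m]. *)
Lemma adj_ev k p q m : adj al be H (p *: ev k, q *: ev k, m *: ev k) =
  ((p - lam k * sgain al be p q + m) *: ev k, (p + q) *: ev k, m *: ev k).
Proof.
rewrite /adj gain_ev /= -scalemxAr Hev scalerA -!scalerDl -scalerBl.
by congr (_ *: _, _, _); ring.
Qed.

Lemma quartZ x r y : quart (x *: r) y = x ^+ 2 * quart r y.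
Proof.
rewrite /quart -RintegralZl//; last by case: (saa r y).
by congr Rintegral; apply/funext => z; rewrite dotvZl; ring.
Qed.

Lemma quart_ge0 r y : 0 <= quart r y.
Proof. by apply: Rintegral_ge0 => z _; exact: sqr_ge0. Qed.

Lemma thstate_sum t w : (thstate t w).2 = \sum_(i < t) (thstate i w).1.1.
Proof.
elim: t => [|t IH]; first by rewrite big_ord0.
by rewrite big_ord_recr -IH.
Qed.

Lemma integ_dotv2 t p : integ P (fun w => dotv p (thstate t w).1.1 ^+ 2).
Proof. by under eq_fun do rewrite -lf_x; case: (sqint_thstate t (p, 0, 0)). Qed.

Lemma integ_energy t :
  integ P (fun w => dotv (thstate t w).1.1 (H *m (thstate t w).1.1)).
Proof.
under eq_fun do rewrite dotvHE.
by apply: integ_sum => k; apply: integZ; exact: integ_dotv2.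
Qed.

Definition energy t : R :=
  EP (fun w => dotv (thstate t w).1.1 (H *m (thstate t w).1.1)).

Lemma energyE t : energy t = \sum_k lam k * c t (ev k, 0, 0).
Proof.
rewrite /energy; under eq_Rintegral do rewrite dotvHE.
rewrite Rintegral_sumT => [|k]; last by apply: integZ; exact: integ_dotv2.
apply: eq_bigr => k _; rewrite RintegralZl//; last exact: integ_dotv2.
by under [in RHS]eq_Rintegral do rewrite lf_x.
Qed.

Lemma energy_sumE t :
  integ P (fun w => dotv (thstate t w).2 (H *m (thstate t w).2)) /\
  EP (fun w => dotv (thstate t w).2 (H *m (thstate t w).2)) =
  \sum_k lam k * c t (0, 0, ev k).
Proof.
have lfS m w : lf (0, 0, m) (thstate t w) = dotv m (thstate t w).2.
  by rewrite /lf /= !dotv0l !add0r.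
have i2 m : integ P (fun w => dotv m (thstate t w).2 ^+ 2).
  by under eq_fun do rewrite -lfS; case: (sqint_thstate t (0, 0, m)).
split.
  under eq_fun do rewrite dotvHE.
  by apply: integ_sum => k; exact: integZ.
under eq_Rintegral do rewrite dotvHE.
rewrite Rintegral_sumT => [|k]; last exact: integZ.
apply: eq_bigr => k _; rewrite RintegralZl//.
by under [in RHS]eq_Rintegral do rewrite lfS.
Qed.

(** * Bias: the process without label noise *)

Section Bias.
Hypothesis e0 : forall z, e z = 0.

Definition orbit k j : 'cV[R]_n * 'cV[R]_n * 'cV[R]_n :=
  ((adjpq al be (lam k) j).1 *: ev k, (adjpq al be (lam k) j).2 *: ev k, 0).

Lemma noise0 r : noise r = 0.
Proof.
rewrite /noise -[RHS](Rintegral_cstT rho); congr Rintegral.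
by apply/funext => z; rewrite e0; ring.
Qed.

Lemma orbit_step t k j : c t.+1 (orbit k j) <= c t (orbit k j.+1)
  + sgain al be (adjpq al be (lam k) j).1 (adjpq al be (lam k) j).2 ^+ 2
    * EP (fun w => quart (ev k) (thstate t w).1.1).
Proof.
apply: le_trans (second_moment_step t (orbit k j) (or_intror e0)) _.
rewrite noise0 mulr0 addr0 gain_ev.
have -> : adj al be H (orbit k j) = orbit k j.+1.
  rewrite /orbit -(scale0r (ev k)) adj_ev /=.
  by case: (adjpq _ _ _ j) => p q /=; rewrite addr0.
rewrite lerD2l; under eq_Rintegral do rewrite quartZ.
by rewrite RintegralZl//; apply: integ_quart; exact: sqint_thstate.
Qed.

(** Induction on the horizon for all starting times. Moving the bound from time [t + 1] back to [t]
    advances each orbit by one step and costs [2/3] of [energy t]; the constant 3 closes the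
    induction because [1 + 3 * (2/3) = 3]. *)
Lemma energy_telescope m t : \sum_(i < m.+1) energy (t + i) <=
  3 * \sum_k lam k * \sum_(j < m.+1) c t (orbit k j).
Proof.
have c_ge0 s u : 0 <= c s u by apply: Rintegral_ge0 => w _; exact: sqr_ge0.
have orbit0 k : orbit k 0 = (ev k, 0, 0) by rewrite /orbit /= scale1r scale0r.
elim: m t => [|m IH] t.
  rewrite big_ord1 addn0 energyE.
  under [in leRHS]eq_bigr do rewrite big_ord1 orbit0.
  have : 0 <= \sum_k lam k * c t (ev k, 0, 0).
    by apply: sumr_ge0 => k _; rewrite mulr_ge0// ltW.
  by lra.
rewrite big_ord_recl addn0.
under eq_bigr do rewrite /bump /= addnA addn1.
pose nq k := EP (fun w => quart (ev k) (thstate t w).1.1).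
have nq_le : \sum_k wt k * nq k <= 2 / 3 * energy t.
  have iq k : integ P (fun w => wt k * quart (ev k) (thstate t w).1.1).
    by apply: integZ; apply: integ_quart; exact: sqint_thstate.
  have -> : \sum_k wt k * nq k =
      EP (fun w => \sum_k wt k * quart (ev k) (thstate t w).1.1).
    rewrite Rintegral_sumT//; apply: eq_bigr => k _; rewrite RintegralZl//.
    by apply: integ_quart; exact: sqint_thstate.
  rewrite /energy -RintegralZl//; last exact: integ_energy.
  apply: le_RintegralT => //; first exact: integ_sum.
  by apply: integZ; exact: integ_energy.
(* The noise injected along direction [k] is weighted by the sum of squared gains, at most [wt k] by
   [sum_sgain_le]. *)
have stepm : \sum_k lam k * \sum_(j < m.+1) c t.+1 (orbit k j) <=
    \sum_k lam k * \sum_(j < m.+1) c t (orbit k j.+1) + 2 / 3 * energy t.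
  apply: le_trans (lerD (lexx _) nq_le); rewrite -big_split /=.
  apply: ler_sum => k _.
  have nq0 : 0 <= nq k by apply: Rintegral_ge0 => w _; exact: quart_ge0.
  have := ler_wpM2r nq0 (sum_sgain_le al be (lam k) al0 be0 (lam0 k) (step_le k)
    (al_be k) m.+1).
  rewrite -/(wt k) => /(lerD (lexx (lam k * \sum_(j < m.+1) c t (orbit k j.+1)))).
  apply: le_trans; rewrite -mulr_sumr -mulrA -mulrDr; apply: ler_wpM2l; first exact: ltW.
  rewrite mulr_suml -big_split /=; apply: ler_sum => j _; exact: orbit_step.
have split0 : \sum_k lam k * \sum_(j < m.+2) c t (orbit k j) =
    energy t + \sum_k lam k * \sum_(j < m.+1) c t (orbit k j.+1).
  rewrite energyE -big_split /=; apply: eq_bigr => k _.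
  by rewrite big_ord_recl orbit0 mulrDr.
rewrite split0; have := IH t.+1; lra.
Qed.

(** The majorant [B] is free so that both the constant bound [adjpq_al] and the linear bound
    [adjpq_be] can be inserted. The factor [T + 1] is Cauchy-Schwarz over the summed iterates. *)
Lemma bias_bound T (B : nat -> R) :
  (forall k j, lam k * ((adjpq al be (lam k) j).1 + (adjpq al be (lam k) j).2) ^+ 2
     <= B j) ->
  EP (fun w => dotv (thstate T.+1 w).2 (H *m (thstate T.+1 w).2)) <=
  3 * T.+1%:R * (\sum_(j < T.+1) B j) * dotv w0 w0.
Proof.
move=> leB.
have c0 k j : c 0%N (orbit k j) =
    ((adjpq al be (lam k) j).1 + (adjpq al be (lam k) j).2) ^+ 2 * dotv (ev k) w0 ^+ 2.
  rewrite -[RHS](Rintegral_cstT P); congr Rintegral; apply/funext => w.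
  by rewrite /lf /= !dotvZl dotv0l; ring.
have step1 : \sum_(i < T.+1) energy i <= 3 * (\sum_(j < T.+1) B j) * dotv w0 w0.
  apply: le_trans (energy_telescope T 0) _.
  rewrite -mulrA ler_pM2l// frame mulr_sumr; apply: ler_sum => k _.
  rewrite mulr_sumr mulr_suml; apply: ler_sum => j _.
  by rewrite c0 -expr2 [leLHS]mulrA; apply: ler_wpM2r => //; exact: sqr_ge0.
have [iS _] := energy_sumE T.+1.
have -> : 3 * T.+1%:R * (\sum_(j < T.+1) B j) * dotv w0 w0 =
   T.+1%:R * (3 * (\sum_(j < T.+1) B j) * dotv w0 w0) by ring.
apply: le_trans (ler_wpM2l _ step1); last exact: ler0n.
rewrite /energy -Rintegral_sumT => [|i]; last exact: integ_energy.
rewrite -RintegralZl//; last by apply: integ_sum => i; exact: integ_energy.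
apply: le_RintegralT => //.
  by apply: integZ; apply: integ_sum => i; exact: integ_energy.
move=> w; rewrite thstate_sum dotvHE.
under [in leRHS]eq_bigr do rewrite dotvHE.
rewrite exchange_big /= mulr_sumr; apply: ler_sum => k _.
rewrite -mulr_sumr [leRHS]mulrCA; apply: ler_wpM2l; first exact: ltW.
by rewrite dotv_sumr; exact: sqr_sum_le.
Qed.

End Bias.

(** * Variance: the process started at the minimizer *)

Section Variance.
Hypothesis w00 : w0 = 0.

(** The multiplicative noise contributes [3 t^2 * (2/3) = 2 t^2] and the label noise [(t + 1)^2], in
    units of [sg2 |r|_H^2]. *)
Lemma noise_level t r :
  (forall p, c t (p, 0, 0) <= 3 * t%:R ^+ 2 * sg2 * \sum_k wt k * dotv (ev k) p ^+ 2) ->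
  EP (fun w => quart r (thstate t w).1.1) + t.+1%:R ^+ 2 * noise r <=
  3 * t.+1%:R ^+ 2 * sg2 * dotv r (H *m r).
Proof.
move=> cle; set K := 3 * t%:R ^+ 2 * sg2.
pose V p := K * \sum_k wt k * dotv (ev k) p ^+ 2.
have VE : (fun z => dotv r (a z) ^+ 2 * V (a z)) = (fun z =>
    K * \sum_k wt k * (dotv (ev k) (a z) * dotv r (a z)) ^+ 2).
  apply/funext => z; rewrite /V mulrCA; congr (_ * _); rewrite mulr_sumr.
  by apply: eq_bigr => k _; ring.
have iq k : integ rho (fun z => wt k * (dotv (ev k) (a z) * dotv r (a z)) ^+ 2).
  by apply: integZ; case: (saa (ev k) r).
have iV : integ rho (fun z => dotv r (a z) ^+ 2 * V (a z)).
  by rewrite VE; apply: integZ; exact: integ_sum.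
have cleV p : EP (fun w => dotv p (thstate t w).1.1 ^+ 2) <= V p.
  by under eq_Rintegral do rewrite -lf_x; exact: cle.
have := quart_le t r V iV cleV.
rewrite VE RintegralZl//; last exact: integ_sum.
rewrite Rintegral_sumT//.
under [X in _ <= _ * X -> _]eq_bigr => k _.
  rewrite RintegralZl//; last by case: (saa (ev k) r).
  over.
move=> h1; have h2 := quart_wt r; have h3 := noise_le r.
have K0 : 0 <= K by rewrite !mulr_ge0// ?sqr_ge0.
have h4 := ler_wpM2l K0 h2.
have h5 := ler_wpM2l (sqr_ge0 t.+1%:R) h3.
have D0 : 0 <= sg2 * dotv r (H *m r).
  rewrite mulr_ge0// dotvHE sumr_ge0// => k _.
  by rewrite mulr_ge0 ?sqr_ge0// ltW.
have tt : t%:R ^+ 2 <= t.+1%:R ^+ 2 :> R by rewrite ler_sqr ?nnegrE// ler_nat.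
have h6 := ler_wpM2r D0 tt.
have -> : 3 * t.+1%:R ^+ 2 * sg2 * dotv r (H *m r) =
  3 * (t.+1%:R ^+ 2 * (sg2 * dotv r (H *m r))) by ring.
have h7 : K * (2 / 3 * dotv r (H *m r)) = 2 * (t%:R ^+ 2 * (sg2 * dotv r (H *m r))).
  by rewrite /K; field.
rewrite /quart in h4 *; lra.
Qed.

(** The case [q = 0] of the induction hypothesis is what [noise_level] requires; the new noise is
    then absorbed by the decrease in [lyap_step]. *)
Lemma variance_lyap t p q : c t (p, q, 0) <= 3 * t%:R ^+ 2 * sg2 *
  \sum_k lyap al be (lam k) (dotv (ev k) p) (dotv (ev k) q).
Proof.
elim: t p q => [|t IH] p q.
  rewrite expr0n /= mulr0 !mul0r -[leRHS](Rintegral_cstT P).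
  rewrite le_eqVlt; apply/orP; left; apply/eqP; congr Rintegral; apply/funext => w.
  by rewrite /lf /= w00 !dotv0r !addr0 expr0n.
set u := (p, q, 0); set r := gain al be u.
apply: le_trans (second_moment_step t u (or_introl w00)) _; rewrite -/r -addrA.
have cle v : c t (v, 0, 0) <= 3 * t%:R ^+ 2 * sg2 * \sum_k wt k * dotv (ev k) v ^+ 2.
  apply: le_trans (IH v 0) _; rewrite le_eqVlt; apply/orP; left; apply/eqP.
  by congr (_ * _); apply: eq_bigr => k _; rewrite dotv0r lyap_p0.
have rk k : dotv (ev k) r = sgain al be (dotv (ev k) p) (dotv (ev k) q).
  by rewrite /r /gain /sgain /= dotvDr !dotvZr.
apply: le_trans (lerD (IH (p + 0 - H *m r) (p + q)) (noise_level t r cle)) _.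
rewrite dotvHE; set S1 := \sum_k lyap _ _ _ _ _.
have S1_ge0 : 0 <= S1 by apply: sumr_ge0 => k _; apply: lyap_ge0 => //; exact: al_be k.
have tt : t%:R ^+ 2 <= t.+1%:R ^+ 2 :> R by rewrite ler_sqr ?nnegrE// ler_nat.
have le1 : 3 * t%:R ^+ 2 * sg2 * S1 <= 3 * t.+1%:R ^+ 2 * sg2 * S1.
  by apply: ler_wpM2r => //; apply: ler_wpM2r => //; apply: ler_wpM2l.
apply: le_trans (lerD le1 (lexx _)) _; rewrite -mulrDr; apply: ler_wpM2l.
  by rewrite !mulr_ge0// sqr_ge0.
rewrite /S1 -big_split /=; apply: ler_sum => k _.
rewrite addr0 dotvDr dotvNr ev_mulmx dotvDr rk.
by apply: lyap_step => //; exact: al_be k.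
Qed.

(** The third component [ev k] acts as a constant source while [(p, q)] stays in [source_inv]. Each
    step adds [noise_level] with [lam r^2 <= 9 / lam], and [3 * 9 = 27]. *)
Lemma variance_source k t p q : source_inv al be (lam k) p q ->
  c t (p *: ev k, q *: ev k, ev k) <=
  27 * sg2 * (dotv (ev k) (ev k) / lam k) * \sum_(i < t) i.+1%:R ^+ 2.
Proof.
elim: t p q => [|t IH] p q pq.
  rewrite big_ord0 mulr0 -[leRHS](Rintegral_cstT P).
  rewrite le_eqVlt; apply/orP; left; apply/eqP; congr Rintegral; apply/funext => w.
  by rewrite /lf /= w00 !dotv0r !addr0 expr0n.
set u := (_, _, _); apply: le_trans (second_moment_step t u (or_introl w00)) _.
rewrite -addrA.
have cle v : c t (v, 0, 0) <= 3 * t%:R ^+ 2 * sg2 * \sum_k wt k * dotv (ev k) v ^+ 2.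
  apply: le_trans (variance_lyap t v 0) _; rewrite le_eqVlt; apply/orP; left; apply/eqP.
  by congr (_ * _); apply: eq_bigr => i _; rewrite dotv0r lyap_p0.
have := noise_level t (gain al be u) cle.
have -> : adj al be H u = ((p - lam k * sgain al be p q + 1) *: ev k,
    (p + q) *: ev k, ev k).
  by rewrite /u -[in LHS](scale1r (ev k)) !scalerA !mulr1 adj_ev scale1r.
rewrite gain_ev -scalemxAr Hev !dotvZl !dotvZr => nl.
apply: le_trans (lerD (IH _ _ (source_inv_step al be (lam k) al0 be0 (lam0 k)
  (step_le k) (al_be k) _ _ pq)) nl) _.
rewrite big_ord_recr /= [leRHS]mulrDr lerD2l.
have := source_inv_sgain al be (lam k) al0 be0 (lam0 k) (step_le k) (al_be k) _ _ pq.
set r := sgain _ _ _ _ => rle; set D := dotv (ev k) (ev k).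
have D0 : 0 <= 3 * t.+1%:R ^+ 2 * sg2 * D by rewrite !mulr_ge0 ?sqr_ge0 ?dotvv_ge0.
have -> : 3 * t.+1%:R ^+ 2 * sg2 * (r * (r * (lam k * D))) =
  3 * t.+1%:R ^+ 2 * sg2 * D * (lam k * r ^+ 2) by ring.
apply: le_trans (ler_wpM2l D0 rle) _.
rewrite le_eqVlt; apply/orP; left; apply/eqP; field; exact: lt0r_neq0.
Qed.

(** Trace of the identity in a Parseval frame: the origin of the dimension factor. *)
Lemma frame_trace : \sum_k dotv (ev k) (ev k) = n%:R.
Proof.
rewrite /dotv exchange_big /= (eq_bigr (fun=> 1)); last first.
  move=> i _; transitivity (dotv (delta_mx i 0) (delta_mx i 0) : R).
    rewrite frame; apply: eq_bigr => k _.
    by rewrite ![dotv (ev k) _]dotvC !dotv_delta.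
  by rewrite dotv_delta mxE !eqxx.
by rewrite sumr_const card_ord.
Qed.

Lemma variance_bound T :
  EP (fun w => dotv (thstate T w).2 (H *m (thstate T w).2)) <=
  27 * sg2 * n%:R * \sum_(i < T) i.+1%:R ^+ 2.
Proof.
have [_ ->] := energy_sumE T.
rewrite -frame_trace; move: (\sum_(i < T) _) (variance_source ^~ T) => SS source.
rewrite mulr_sumr mulr_suml; apply: ler_sum => k _.
have := source k 0 0 (source_inv0 al be (lam k)).
rewrite !scale0r => /(ler_wpM2l (ltW (lam0 k))) h; apply: le_trans h _.
by rewrite le_eqVlt; apply/orP; left; apply/eqP; field; exact: lt0r_neq0.
Qed.

End Variance.
End EigenBounds.
End Moments.

(** * Consequences of the assumptions on the data *)

Section Data.
Context {R : realType} {n : nat} {dX} {X : measurableType dX}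
  (rho : probability X R) (a : X -> 'cV[R]_n) (b : X -> R)
  (xstar : 'cV[R]_n) (Rc sigma kappa al be : R).
Local Notation ER f := (Rintegral rho setT f).
Local Notation H := (second_moment rho a).
Local Notation eps := (fun z => b z - dotv xstar (a z)).
Hypothesis ma : forall i, measurable_fun setT (fun z => a z i 0).
Hypothesis mb : measurable_fun setT b.
Hypothesis a2 : (\int[rho]_z ((dotv (a z) (a z))%:E) < +oo)%E.
Hypothesis b2 : (\int[rho]_z ((b z ^+ 2)%:E) < +oo)%E.

Lemma qformE (A : 'M[R]_n) v : qform A v = dotv v (A *m v).
Proof. by rewrite /qform dotv_mulmx. Qed.

Lemma measurable_dotv p : measurable_fun setT (fun z => dotv p (a z)).
Proof.
by rewrite /dotv; apply: measurable_sum => i; exact: measurable_funM.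
Qed.

Lemma measurable_norm2 : measurable_fun setT (fun z => dotv (a z) (a z)).
Proof.
by rewrite /dotv; apply: measurable_sum => i; exact: measurable_funM.
Qed.

Lemma integ_norm2 : integ rho (fun z => dotv (a z) (a z)).
Proof.
apply: integ_ge0P => //; first exact: measurable_norm2.
by move=> z; exact: dotvv_ge0.
Qed.

Lemma coord_sq_le (v : 'cV[R]_n) i : v i 0 ^+ 2 <= dotv v v.
Proof.
rewrite /dotv (bigD1 i)//= -expr2 lerDl sumr_ge0// => j _.
by rewrite -expr2 sqr_ge0.
Qed.

Lemma sqint_feature i : sqint rho (fun z => a z i 0).
Proof.
split => //; apply: (le_integ _ _ _ _ integ_norm2) => [|z].
  exact: measurable_funX.
by rewrite ger0_norm ?sqr_ge0// coord_sq_le.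
Qed.

Lemma sqint_dotv p : sqint rho (fun z => dotv p (a z)).
Proof.
by rewrite /dotv; apply: sqint_sum => i; apply: sqintZ; exact: sqint_feature.
Qed.

Lemma sqint_eps : sqint rho eps.
Proof.
apply: sqintB; last exact: sqint_dotv.
split => //; apply: integ_ge0P => // [|z]; last exact: sqr_ge0.
exact: measurable_funX.
Qed.

Lemma second_moment_sym : H^T = H.
Proof.
by apply/matrixP => i j; rewrite !mxE; congr Rintegral; apply/funext => z; rewrite mulrC.
Qed.

Lemma second_momentE p q :
  ER (fun z => dotv p (a z) * dotv q (a z)) = dotv p (H *m q).
Proof.
have iaa i j : integ rho (fun z => a z i 0 * a z j 0).
  by apply: sqintM; exact: sqint_feature.
have -> : (fun z => dotv p (a z) * dotv q (a z)) = (fun z =>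
    \sum_i \sum_j p i 0 * q j 0 * (a z i 0 * a z j 0)).
  apply/funext => z; rewrite /dotv big_distrlr /=.
  by apply: eq_bigr => i _; apply: eq_bigr => j _; ring.
rewrite Rintegral_sumT => [|i]; last by apply: integ_sum => j; exact: integZ.
apply: eq_bigr => i _; rewrite Rintegral_sumT => [|j]; last exact: integZ.
rewrite mxE mulr_sumr; apply: eq_bigr => j _; rewrite RintegralZl// mxE.
by ring.
Qed.

Lemma second_moment_ge0 v : 0 <= dotv v (H *m v).
Proof.
by rewrite -second_momentE; apply: Rintegral_ge0 => z _; rewrite -expr2 sqr_ge0.
Qed.

Let mse_shift v : ER (fun z => (dotv (xstar + v) (a z) - b z) ^+ 2) =
  dotv v (H *m v) - 2 * ER (fun z => eps z * dotv v (a z)) + ER (fun z => eps z ^+ 2).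
Proof.
have i1 : integ rho (fun z => dotv v (a z) * dotv v (a z)).
  by apply: sqintM; exact: sqint_dotv.
have i2 : integ rho (fun z => eps z * dotv v (a z)).
  by apply: sqintM; [exact: sqint_eps|exact: sqint_dotv].
have [_ i3] := sqint_eps; have i4 := integZ _ (-2) _ i2.
have -> : (fun z => (dotv (xstar + v) (a z) - b z) ^+ 2) = (fun z =>
    dotv v (a z) * dotv v (a z) + -2 * (eps z * dotv v (a z)) + eps z ^+ 2).
  by apply/funext => z; rewrite dotvDl; ring.
rewrite (RintegralD _ (integD _ _ _ i1 i4) i3)// (RintegralD _ i1 i4)//.
by rewrite RintegralZl// second_momentE mulNr.
Qed.

Let risk_mse x :
  risk rho a b x = (2^-1 * ER (fun z => (dotv x (a z) - b z) ^+ 2))%:E.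
Proof.
rewrite /risk integralE_fin ?EFinM//.
have [_] := sqint_eps; have := sqintB _ _ _ (sqint_dotv (x - xstar)) sqint_eps.
case=> _ + _; congr (integ rho _); apply/funext => z.
by rewrite dotvDl dotvNl; congr (_ ^+ 2); ring.
Qed.

Hypothesis opt : forall x, (risk rho a b xstar <= risk rho a b x)%E.

(** Normal equations: optimality along the line [xstar + c p] makes [c^2 q - 2 c L] nonnegative for
    every [c]. *)
Lemma eps_orth p : ER (fun z => eps z * dotv p (a z)) = 0.
Proof.
set L := ER _; set q := dotv p (H *m p).
have q0 : 0 <= q by exact: second_moment_ge0.
have i2 : integ rho (fun z => eps z * dotv p (a z)).
  by apply: sqintM; [exact: sqint_eps|exact: sqint_dotv].
have h c : 0 <= c ^+ 2 * q - 2 * c * L.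
  have := opt (xstar + c *: p); rewrite -{1}(addr0 xstar) !risk_mse lee_fin.
  rewrite !mse_shift mulmx0 dotv0r -scalemxAr dotvZl dotvZr -/q.
  have -> : ER (fun z => eps z * dotv 0 (a z)) = 0.
    by under eq_Rintegral do rewrite dotv0l mulr0; exact: Rintegral_cstT.
  have -> : ER (fun z => eps z * dotv (c *: p) (a z)) = c * L.
    by rewrite -RintegralZl//; congr Rintegral; apply/funext => z; rewrite dotvZl; ring.
  by move: (ER _) => E2; lra.
(* Dividing by [q + 1] instead of [q] also covers [q = 0]; the inequality becomes
   [- c^2 (q + 2) >= 0]. *)
pose c := L / (q + 1); have q1 : 0 < q + 1 by lra.
have Lc : L = c * (q + 1) by rewrite /c divfK// gt_eqF.
have := h c; rewrite Lc => hc; have c0 : c ^+ 2 <= 0 by nra.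
suff -> : c = 0 by rewrite mul0r.
by apply/eqP; rewrite -sqrf_eq0 eq_le c0 sqr_ge0.
Qed.

Lemma riskE x : risk rho a b x =
  (2^-1 * (dotv (x - xstar) (H *m (x - xstar)) + ER (fun z => eps z ^+ 2)))%:E.
Proof.
rewrite risk_mse; have -> : x = xstar + (x - xstar) by rewrite addrC subrK.
by rewrite mse_shift eps_orth mulr0 subr0 addrAC subrr add0r.
Qed.

Lemma risk_excess x : risk rho a b x =
  (risk rho a b xstar + (2^-1 * dotv (x - xstar) (H *m (x - xstar)))%:E)%E.
Proof.
by rewrite !riskE subrr mulmx0 dotv0l add0r -EFinD -mulrDr addrC.
Qed.

Lemma loewner_le_Rintegral (w : X -> R) c : measurable_fun setT w ->
  (forall z, 0 <= w z) -> loewner_le_expect rho a w c H ->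
  forall v, integ rho (fun z => w z * dotv v (a z) ^+ 2) /\
    ER (fun z => w z * dotv v (a z) ^+ 2) <= c * dotv v (H *m v).
Proof.
move=> mw w0 hw v; have hv := hw v; rewrite qformE in hv.
have iw : integ rho (fun z => w z * dotv v (a z) ^+ 2).
  apply: integ_ge0P => [|z|].
  - by apply: measurable_funM => //; apply: measurable_funX; exact: measurable_dotv.
  - by rewrite mulr_ge0 ?sqr_ge0.
  - by apply: le_lt_trans hv _; exact: ltry.
by split => //; rewrite -lee_fin -integralE_fin.
Qed.

Hypothesis loewner_R :
  loewner_le_expect rho a (fun z => dotv (a z) (a z)) (Rc ^+ 2) H.
Hypothesis loewner_sigma :
  loewner_le_expect rho a (fun z => (b z - dotv xstar (a z)) ^+ 2) (sigma ^+ 2) H.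
Hypothesis loewner_kappa :
  loewner_le_expect rho a (fun z => qform (invmx H) (a z)) kappa H.

Let loewner_RE v : integ rho (fun z => dotv (a z) (a z) * dotv v (a z) ^+ 2) /\
  ER (fun z => dotv (a z) (a z) * dotv v (a z) ^+ 2) <= Rc ^+ 2 * dotv v (H *m v).
Proof.
apply: (loewner_le_Rintegral _ _ _ _ loewner_R v); first exact: measurable_norm2.
by move=> z; exact: dotvv_ge0.
Qed.

Let loewner_sigmaE v : integ rho (fun z => eps z ^+ 2 * dotv v (a z) ^+ 2) /\
  ER (fun z => eps z ^+ 2 * dotv v (a z) ^+ 2) <= sigma ^+ 2 * dotv v (H *m v).
Proof.
apply: (loewner_le_Rintegral _ _ _ _ loewner_sigma v).
  by apply: measurable_funX; case: sqint_eps.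
by move=> z; exact: sqr_ge0.
Qed.

(** Finiteness of this fourth moment comes from hypothesis (i), since each squared coordinate of [a]
    is at most [|a|^2]. *)
Lemma sqint_dotvM p q : sqint rho (fun z => dotv p (a z) * dotv q (a z)).
Proof.
have -> : (fun z => dotv p (a z) * dotv q (a z)) =
    (fun z => \sum_i p i 0 * (a z i 0 * dotv q (a z))).
  by apply/funext => z; rewrite mulr_suml; apply: eq_bigr => i _; rewrite mulrA.
apply: sqint_sum => i; apply: sqintZ; have mq := measurable_dotv q.
split; first exact: measurable_funM.
have [iq _] := loewner_RE q; apply: (le_integ _ _ _ _ iq) => [|z].
  by apply: measurable_funX; exact: measurable_funM.
rewrite ger0_norm ?sqr_ge0// exprMn ler_wpM2r ?sqr_ge0//; exact: coord_sq_le.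
Qed.

Lemma sqint_epsM p : sqint rho (fun z => eps z * dotv p (a z)).
Proof.
split; last by under eq_fun do rewrite exprMn; case: (loewner_sigmaE p).
by apply: measurable_funM; [case: sqint_eps|exact: measurable_dotv].
Qed.

Lemma noise_eps r : noise rho a eps r <= sigma ^+ 2 * dotv r (H *m r).
Proof.
by rewrite /noise; under eq_Rintegral do rewrite exprMn; case: (loewner_sigmaE r).
Qed.

(** * Spectral consequences of the Loewner bounds *)

Section EigenData.
Context {I : finType} (ev : I -> 'cV[R]_n) (lam : I -> R).
Hypothesis H_unit : H \in unitmx.
Hypothesis Hev : forall k, H *m ev k = lam k *: ev k.
Hypothesis lam_ev : forall k, exists2 v : 'cV[R]_n, v != 0 & H *m v = lam k *: v.
Hypothesis frame : forall x y : 'cV[R]_n,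
  dotv x y = \sum_k dotv (ev k) x * dotv (ev k) y.

Lemma lam_gt0 k : 0 < lam k.
Proof.
have [v v0 Hv] := lam_ev k; rewrite lt_neqAle; apply/andP; split.
  apply: contra v0 => /eqP lam0; apply/eqP.
  by rewrite -(mulKmx H_unit v) Hv -lam0 scale0r mulmx0.
have := second_moment_ge0 v; rewrite Hv dotvZr.
by rewrite pmulr_lge0// dotvv_gt0.
Qed.

Lemma qform_invE y : qform (invmx H) y = \sum_k dotv (ev k) y ^+ 2 / lam k.
Proof.
have Hiev k : invmx H *m ev k = (lam k)^-1 *: ev k.
  rewrite -[in LHS](scale1r (ev k)) -(@mulVf _ (lam k)) ?gt_eqF ?lam_gt0//.
  by rewrite -scalerA -Hev -scalemxAr mulKmx.
have iHsym : (invmx H)^T = invmx H by rewrite trmx_inv second_moment_sym.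
rewrite qformE frame; apply: eq_bigr => k _.
rewrite -{1}iHsym -dotv_mulmx_tr Hiev dotvZl; ring.
Qed.

(** Weighted Cauchy-Schwarz by completing squares at the optimal multiplier [c = s / g]. *)
Lemma frame_CS (m x y : I -> R) : (forall k, 0 < m k) ->
  0 < \sum_k m k * x k ^+ 2 ->
  (\sum_k x k * y k) ^+ 2 <= (\sum_k y k ^+ 2 / m k) * \sum_k m k * x k ^+ 2.
Proof.
move=> m0; set g := \sum_k m k * _; set s := \sum_k x k * _ => g0.
rewrite -ler_pdivrMr//; set c := s / g.
have -> : s ^+ 2 / g = 2 * c * s - c ^+ 2 * g by rewrite /c; field; exact: lt0r_neq0.
rewrite /s /g !mulr_sumr -sumrB; apply: ler_sum => k _; rewrite -subr_ge0.
have -> : y k ^+ 2 / m k - (2 * c * (x k * y k) - c ^+ 2 * (m k * x k ^+ 2)) =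
    (y k - c * m k * x k) ^+ 2 / m k by field; exact: lt0r_neq0.
by rewrite divr_ge0 ?sqr_ge0// ltW.
Qed.

(* Jensen, after bounding the weight below by [<v,a>^2 / g]. *)
Lemma weight_Jensen (w : X -> R) v g : 0 < g ->
  integ rho (fun z => w z * dotv v (a z) ^+ 2) ->
  (forall z, dotv v (a z) ^+ 2 <= w z * g) ->
  dotv v (H *m v) ^+ 2 <= g * ER (fun z => w z * dotv v (a z) ^+ 2).
Proof.
move=> g0 iw wg; set t := dotv v (H *m v).
have [_ i2] := sqint_dotv v.
have i3 := integZ _ (2 * t) _ i2.
(* [t] is the mean of [<v,a>^2], and [2 t s - t^2] is the tangent to [s^2] there. *)
rewrite -RintegralZl//; have -> : t ^+ 2 =
    ER (fun z => 2 * t * dotv v (a z) ^+ 2 - t ^+ 2).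
  rewrite (RintegralB _ i3 (integ_cst _ _))// Rintegral_cstT RintegralZl//.
  by under eq_Rintegral do rewrite expr2; rewrite second_momentE -/t; ring.
apply: le_RintegralT => [| |z].
- by apply: integB => //; exact: integ_cst.
- exact: integZ.
set s := dotv v (a z) ^+ 2; have s0 : 0 <= s by exact: sqr_ge0.
have := ler_wpM2r s0 (wg z); rewrite -/s; have := sqr_ge0 (s - t); nra.
Qed.

(** [weight_Jensen] at an eigenvector, with weight [|a|^2], combined with (i). *)
Lemma lam_le k : lam k <= Rc ^+ 2.
Proof.
have [v v0 Hv] := lam_ev k; have [iR leR] := loewner_RE v.
have vv0 := dotvv_gt0 _ v0; have l0 := lam_gt0 k.
have := weight_Jensen _ v (dotv v v) vv0 iR.
have CS z : dotv v (a z) ^+ 2 <= dotv (a z) (a z) * dotv v v.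
  have e1 : \sum_i 1 * dotv (ev i) v ^+ 2 = dotv v v.
    by rewrite [RHS]frame; apply: eq_bigr => i _; rewrite mul1r.
  have e2 : \sum_i dotv (ev i) (a z) ^+ 2 / 1 = dotv (a z) (a z).
    by rewrite [RHS]frame; apply: eq_bigr => i _; rewrite divr1.
  rewrite [dotv v (a z)]frame -e2 -[in leRHS]e1.
  by apply: (frame_CS (fun=> 1)) => //; rewrite e1.
move=> /(_ CS) h; have := le_trans h (ler_wpM2l (ltW vv0) leR).
rewrite Hv dotvZr.
have -> : (lam k * dotv v v) ^+ 2 = (lam k * dotv v v ^+ 2) * lam k by ring.
have -> : dotv v v * (Rc ^+ 2 * (lam k * dotv v v)) =
  (lam k * dotv v v ^+ 2) * Rc ^+ 2 by ring.
by rewrite ler_pM2l// mulr_gt0// exprn_gt0.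
Qed.

Let loewner_kappaE v :
  integ rho (fun z => (\sum_k dotv (ev k) (a z) ^+ 2 / lam k) * dotv v (a z) ^+ 2) /\
  ER (fun z => (\sum_k dotv (ev k) (a z) ^+ 2 / lam k) * dotv v (a z) ^+ 2) <=
  kappa * dotv v (H *m v).
Proof.
apply: loewner_le_Rintegral => [|z|].
- apply: measurable_sum => k; apply: measurable_funM => //.
  by apply: measurable_funX; exact: measurable_dotv.
- by apply: sumr_ge0 => k _; rewrite divr_ge0 ?sqr_ge0// ltW// lam_gt0.
- move: loewner_kappa; congr (loewner_le_expect _ _ _ _ _).
  by apply/funext => z; rewrite qform_invE.
Qed.

(** Same argument with the weight [|a|^2] in the norm of [H^-1] and hypothesis (iii). An index is
    required: in dimension zero, (iii) does not constrain [kappa]. *)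
Lemma kappa_ge1 : I -> 1 <= kappa.
Proof.
move=> k; have [v v0 Hv] := lam_ev k; have [iK leK] := loewner_kappaE v.
have vv0 := dotvv_gt0 _ v0; have l0 := lam_gt0 k.
have HvE : dotv v (H *m v) = \sum_i lam i * dotv (ev i) v ^+ 2.
  rewrite frame; apply: eq_bigr => i _.
  by rewrite -[in LHS]second_moment_sym -dotv_mulmx_tr Hev dotvZl; ring.
have g0 : 0 < dotv v (H *m v) by rewrite Hv dotvZr mulr_gt0.
have CS z : dotv v (a z) ^+ 2 <=
    (\sum_i dotv (ev i) (a z) ^+ 2 / lam i) * dotv v (H *m v).
  by rewrite HvE [dotv v (a z)]frame; apply: frame_CS; [exact: lam_gt0|rewrite -HvE].
have := le_trans (weight_Jensen _ v _ g0 iK CS) (ler_wpM2l (ltW g0) leK).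
by rewrite mulrCA -expr2 -[leLHS]mul1r ler_pM2r// exprn_gt0.
Qed.

Hypotheses (al0 : 0 < al) (be0 : 0 < be).
Hypothesis step_R : (al + 2 * be) * Rc ^+ 2 <= 1.
Hypothesis step_kappa : al <= be / (2 * kappa).

Lemma step_lam k : (al + 2 * be) * lam k <= 1.
Proof.
apply: le_trans step_R; apply: ler_wpM2l; last exact: lam_le.
by move: al0 be0; lra.
Qed.

Lemma al_le_be : I -> 2 * al <= be.
Proof.
move=> k; have k1 := kappa_ge1 k; move: step_kappa; rewrite ler_pdivlMr; last by lra.
by move: al0; nra.
Qed.

(** Summed over the frame, the two parts of [wt] rebuild the weights of (iii) and (i). The
    conditions on [al / be] and on [al + 2 be] make each contribute at most [1/3]. *)
Lemma quart_wt_le y :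
  \sum_k wt al be lam k * quart rho a (ev k) y <= 2 / 3 * dotv y (H *m y).
Proof.
have [k0 _|I0] := pickP (fun _ : I => true); last first.
  by rewrite big_pred0// mulr_ge0 ?second_moment_ge0//; lra.
have k1 := kappa_ge1 k0.
have [iR leR] := loewner_RE y; have [iK leK] := loewner_kappaE y.
set c1 := 2 / 3 * (al / be); set c2 := (al + 2 * be) / 3.
have c1_ge0 : 0 <= c1 by rewrite mulr_ge0 ?divr_ge0// ltW.
have c2_ge0 : 0 <= c2 by rewrite /c2; move: al0 be0; lra.
have -> : \sum_k wt al be lam k * quart rho a (ev k) y =
    c1 * ER (fun z => (\sum_k dotv (ev k) (a z) ^+ 2 / lam k) * dotv y (a z) ^+ 2)
    + c2 * ER (fun z => dotv (a z) (a z) * dotv y (a z) ^+ 2).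
  rewrite -!RintegralZl// -RintegralD//; try exact: integZ.
  have iq k : integ rho (fun z => (dotv (ev k) (a z) * dotv y (a z)) ^+ 2).
    by case: (sqint_dotvM (ev k) y).
  transitivity (\sum_k ER (fun z => wt al be lam k *
      (dotv (ev k) (a z) * dotv y (a z)) ^+ 2)).
    by apply: eq_bigr => k _; rewrite RintegralZl.
  rewrite -Rintegral_sumT => [|k]; last exact: integZ.
  congr Rintegral; apply/funext => z; rewrite [dotv (a z) _]frame.
  rewrite !mulr_suml !mulr_sumr -big_split /=; apply: eq_bigr => k _.
  by rewrite /wt /c1 /c2; field; rewrite !gt_eqF ?lam_gt0.
have h1 := ler_wpM2l c1_ge0 leK; have h2 := ler_wpM2l c2_ge0 leR.
apply: le_trans (lerD h1 h2) _.
rewrite !mulrA -mulrDl; apply: ler_wpM2r; first exact: second_moment_ge0.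
have c1k : c1 * kappa <= 1 / 3.
  move: step_kappa; rewrite ler_pdivlMr; last by lra.
  have -> : c1 * kappa = 1 / 3 * (al * (2 * kappa) / be).
    by rewrite /c1; field; exact: lt0r_neq0.
  by move=> h; rewrite ler_piMr// ler_pdivrMr// mul1r.
have c2R : c2 * Rc ^+ 2 <= 1 / 3 by rewrite /c2 mulrAC ler_pM2r// invr_gt0.
by rewrite -[c2 * Rc * Rc]mulrA -expr2; apply: le_trans (lerD c1k c2R) _; lra.
Qed.

End EigenData.
End Data.

(** * Conclusion *)

Lemma sqrD_le {R : realFieldType} (x y : R) : (x + y) ^+ 2 <= 2 * (x ^+ 2 + y ^+ 2).
Proof. by have := sqr_ge0 (x - y); nra. Qed.

(** Multiplying by [t + 1] absorbs the averaging weights and turns the growing step of [z] into a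
    constant one. *)
Lemma acsgd_proc {R : realType} {n : nat} (al be : R) (x0 xstar : 'cV[R]_n)
    (A : nat -> 'cV[R]_n) (B : nat -> R) t :
  let th := proc al be (x0 - xstar) A (fun j => B j - dotv xstar (A j)) t in
  t.+1%:R *: (acsgd_x al be x0 A B t - xstar) = th.1.1 /\
  (acsgd_state al be x0 A B t).2 - xstar = th.1.2.
Proof.
elim: t => [|t /= [IHx IHz]]; first by rewrite /= scale1r.
rewrite /acsgd_x /= in IHx *; set x := (acsgd_state al be x0 A B t).1 in IHx *.
set z := (acsgd_state al be x0 A B t).2 in IHz *.
set th := proc _ _ _ _ _ _ in IHx IHz *.
have gE : t.+1%:R *: ((dotv (A t) x - B t) *: A t) =
    (dotv (A t) th.1.1 - t.+1%:R * (B t - dotv xstar (A t))) *: A t.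
  rewrite -IHx scalerA; congr (_ *: _).
  by rewrite dotvZr dotvDr dotvNr (dotvC xstar); ring.
rewrite -gE -IHx -IHz; set g := _ *: A t; split; last first.
  by rewrite scalerA [in RHS]addrAC.
have t2 : t.+2%:R != 0 :> R by rewrite pnatr_eq0.
rewrite [LHS]scalerBr [X in X - _ = _]scalerA mulfV// scale1r.
apply/matrixP => i j; rewrite !mxE -natr1; ring.
Qed.

Lemma sum_succ {R : realFieldType} T :
  \sum_(i < T) i.+1%:R = T%:R * (T%:R + 1) / 2 :> R.
Proof.
elim: T => [|T IH]; first by rewrite big_ord0 !mul0r.
by rewrite big_ord_recr /= IH -natr1; field.
Qed.

Lemma sum_succ_sqr {R : realFieldType} T :
  \sum_(i < T) i.+1%:R ^+ 2 = T%:R * (T%:R + 1) * (2 * T%:R + 1) / 6 :> R.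
Proof.
elim: T => [|T IH]; first by rewrite big_ord0 !mul0r.
by rewrite big_ord_recr /= IH -natr1; field.
Qed.

Lemma acsgd_xbar_proc {R : realType} {n : nat} (al be : R) (x0 xstar : 'cV[R]_n)
    (A : nat -> 'cV[R]_n) (B : nat -> R) T :
  acsgd_xbar al be x0 A B T - xstar = (\sum_(t < T.+1) (t.+1)%:R)^-1 *:
    (proc al be (x0 - xstar) A (fun j => B j - dotv xstar (A j)) T.+1).2.
Proof.
pose w0 := x0 - xstar; pose B' j := B j - dotv xstar (A j); rewrite -/w0 -/B'.
set C : R := \sum_(t < T.+1) _.
have C0 : C != 0.
  by rewrite /C sum_succ !mulf_neq0 ?invr_eq0 ?pnatr_eq0// natr1 pnatr_eq0.
have -> : (proc al be w0 A B' T.+1).2 = \sum_(t < T.+1) (proc al be w0 A B' t).1.1.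
  elim: (T.+1) => [|t IH]; first by rewrite big_ord0.
  by rewrite big_ord_recr -IH.
rewrite /acsgd_xbar -/C; apply: (scalerI C0).
rewrite scalerBr !scalerA mulfV// !scale1r /C scaler_suml -sumrB.
apply: eq_bigr => t _; rewrite -scalerBr.
by have [->] := acsgd_proc al be x0 xstar A B t.
Qed.

(* [D] is |x0 - xstar|^2, [V] is sigma^2 d, and [E] the sum of the bias and
   variance estimates of E|S|_H^2. *)
Lemma rate_arith {R : realFieldType} (t al be D V E : R) :
  1 <= t -> 0 < al -> 0 < be -> 0 <= D -> 0 <= V ->
  E <= 3 * (t + 1) * ((t + 1) / al) * D
       + 27 * V * ((t + 1) * (t + 2) * (2 * t + 3) / 6) ->
  E <= 3 * (t + 1) * ((t + 1) * (t + 2) / 2 / be) * D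
       + 27 * V * ((t + 1) * (t + 2) * (2 * t + 3) / 6) ->
  ((t + 1) * (t + 2) / 2)^-1 ^+ 2 * E <=
  Num.min (12 / (al * t ^+ 2)) (48 / (be * t)) * D + 72 * V / t.
Proof.
move=> t1 al0 be0 D0 V0 E1 E2; set C := _^-1 ^+ 2.
have t0 : 0 < t by lra.
have u0 : 0 < t + 1 by lra.
have w0 : 0 < t + 2 by lra.
have C0 : 0 <= C by exact: sqr_ge0.
have var : C * (27 * V * ((t + 1) * (t + 2) * (2 * t + 3) / 6)) <= 72 * V / t.
  have -> : C * (27 * V * ((t + 1) * (t + 2) * (2 * t + 3) / 6)) =
      V * (18 * (2 * t + 3) / ((t + 1) * (t + 2))).
    by rewrite /C; field; rewrite !gt_eqF.
  have -> : 72 * V / t = V * (72 / t) by ring.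
  apply: ler_wpM2l => //; rewrite ler_pdivrMr ?mulr_gt0// mulrAC ler_pdivlMr//.
  nra.
apply: le_trans (lerD (lexx _) var); rewrite -lerBlDr.
have le_bias K : E <= K * D + 27 * V * ((t + 1) * (t + 2) * (2 * t + 3) / 6) ->
    C * E - C * (27 * V * ((t + 1) * (t + 2) * (2 * t + 3) / 6)) <= C * K * D.
  by move=> /(ler_wpM2l C0); rewrite mulrDr mulrA; lra.
(* Both bias estimates are available, so the proof uses whichever matches the value of the
   minimum. *)
rewrite minEle; case: ifP => _.
  apply: le_trans (le_bias _ E1) _; apply: ler_wpM2r => //.
  have -> : C * (3 * (t + 1) * ((t + 1) / al)) = 12 / (al * (t + 2) ^+ 2).
    by rewrite /C; field; rewrite !gt_eqF.
  apply: ler_wpM2l => //; rewrite lef_pV2 ?posrE ?mulr_gt0 ?exprn_gt0//.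
  by apply: ler_wpM2l; [exact: ltW|rewrite ler_sqr ?nnegrE; lra].
apply: le_trans (le_bias _ E2) _; apply: ler_wpM2r => //.
have -> : C * (3 * (t + 1) * ((t + 1) * (t + 2) / 2 / be)) = 6 / (be * (t + 2)).
  by rewrite /C; field; rewrite !gt_eqF.
apply: ler_pM => //; first by rewrite invr_ge0 mulr_ge0 ?ltW.
- by lra.
- by rewrite lef_pV2 ?posrE ?mulr_gt0// ler_pM2l//; lra.
Qed.

Theorem theorem1 (R : realType) (dim : nat)
  (dX : measure_display) (X : measurableType dX) (rho : probability X R)
  (a : X -> 'cV[R]_dim) (b : X -> R)
  (dT : measure_display) (Omega : measurableType dT) (P : probability Omega R)
  (xi : nat -> Omega -> X)
  (xstar x0 : 'cV[R]_dim) (Rc sigma kappa alpha beta : R) :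
  (forall i : 'I_dim, measurable_fun setT (fun z => a z i 0)) ->
  measurable_fun setT b ->
  (\int[rho]_z ((dotv (a z) (a z))%:E) < +oo)%E ->
  (\int[rho]_z ((b z ^+ 2)%:E) < +oo)%E ->
  second_moment rho a \in unitmx ->
  (forall x : 'cV[R]_dim, (risk rho a b xstar <= risk rho a b x)%E) ->
  loewner_le_expect rho a (fun z => dotv (a z) (a z)) (Rc ^+ 2) (second_moment rho a) ->
  loewner_le_expect rho a (fun z => (b z - dotv xstar (a z)) ^+ 2) (sigma ^+ 2)
    (second_moment rho a) ->
  loewner_le_expect rho a (fun z => qform (invmx (second_moment rho a)) (a z)) kappa
    (second_moment rho a) ->
  iid_with_law P rho xi ->
  0 < alpha -> 0 < beta ->
  (alpha + 2 * beta) * Rc ^+ 2 <= 1 ->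
  alpha <= beta / (2 * kappa) ->
  forall T : nat, (1 <= T)%N ->
    (\int[P]_w risk rho a b
        (acsgd_xbar alpha beta x0 (fun t => a (xi t w)) (fun t => b (xi t w)) T)
     - risk rho a b xstar
     <= ((Num.min (12 / (alpha * (T%:R) ^+ 2)) (48 / (beta * T%:R)))
           * dotv (x0 - xstar) (x0 - xstar)
         + 72 * sigma ^+ 2 * dim%:R / T%:R)%:E)%E.
Proof.
move=> ma mb a2 b2 H_unit opt LR Lsig Lkap xiP al0 be0 step_R step_k T T1.
set H := second_moment rho a; pose eps z := b z - dotv xstar (a z).
have Hsym : H^T = H by exact: second_moment_sym.
have [I [ev [lam [Hev lam_ev frame]]]] := eigenframe H Hsym.
have sa := sqint_dotv rho a ma a2.
have se : sqint rho eps := sqint_eps rho a b xstar ma mb a2 b2.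
have saa := sqint_dotvM rho a Rc ma LR.
have sea : forall p, sqint rho (fun z => eps z * dotv p (a z)).
  exact: (sqint_epsM rho a b xstar sigma ma mb a2 b2 Lsig).
have Eaa := second_momentE rho a ma a2.
have Eea : forall p, Rintegral rho setT (fun z => eps z * dotv p (a z)) = 0.
  exact: (eps_orth rho a b xstar ma mb a2 b2 opt).
have lam0 := lam_gt0 rho a ma a2 lam H_unit lam_ev.
have step_l := step_lam rho a Rc alpha beta ma a2 LR ev lam H_unit lam_ev frame
  al0 be0 step_R.
have al_be := al_le_be rho a kappa alpha beta ma a2 Lkap ev lam H_unit Hev lam_ev
  frame al0 step_k.
have qwt := quart_wt_le rho a Rc kappa alpha beta ma a2 LR Lkap ev lam H_unit Hev
  lam_ev frame al0 be0 step_R step_k.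
have nle : forall r, noise rho a eps r <= sigma ^+ 2 * dotv r (H *m r).
  exact: (noise_eps rho a b xstar sigma ma mb a2 b2 Lsig).
pose S e w0 w := (thstate a e xi alpha beta w0 T.+1 w).2.
(* The bias process keeps the start [w0] with label noise [zero]; the variance process keeps [eps]
   and starts at 0. *)
pose w0 := x0 - xstar; pose zero (z : X) : R := 0.
have sz : sqint rho zero by exact: sqint_cst.
have sza p : sqint rho (fun z => zero z * dotv p (a z)).
  by under eq_fun do rewrite mul0r; exact: sqint_cst.
have Eza p : Rintegral rho setT (fun z => zero z * dotv p (a z)) = 0.
  by under eq_Rintegral do rewrite mul0r; exact: Rintegral_cstT.
have [iS _] := energy_sumE rho a eps H P xi alpha beta w0 xiP sa se saa sea Eaa Eea
  Hsym ev lam Hev frame T.+1.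
have [iSb _] := energy_sumE rho a zero H P xi alpha beta w0 xiP sa sz saa sza Eaa Eza
  Hsym ev lam Hev frame T.+1.
have [iSv _] := energy_sumE rho a eps H P xi alpha beta 0 xiP sa se saa sea Eaa Eea
  Hsym ev lam Hev frame T.+1.
have bias := bias_bound rho a zero H P xi alpha beta w0 xiP sa sz saa sza Eaa Eza
  Hsym ev lam Hev frame lam0 al0 be0 al_be step_l qwt (fun=> erefl) T.
have var := variance_bound rho a eps H P xi alpha beta 0 xiP sa se saa sea Eaa Eea
  Hsym ev lam (sigma ^+ 2) Hev frame lam0 al0 be0 al_be step_l (sqr_ge0 sigma)
  qwt nle erefl T.+1.
rewrite -!/(S _ _ _) in iS iSb iSv bias var.
have SD k w : dotv (ev k) (S eps w0 w) =
    dotv (ev k) (S zero w0 w) + dotv (ev k) (S eps 0 w).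
  have lfS e v : dotv (ev k) (S e v w) =
      lf (0, 0, ev k) (thstate a e xi alpha beta v T.+1 w).
    by rewrite /lf /= !dotv0l !add0r.
  rewrite !lfS /thstate -procD addr0; congr (lf _ (proc _ _ _ _ _ _)).
  by apply/funext => j; rewrite add0r.
have HE y : dotv y (H *m y) = \sum_k lam k * dotv (ev k) y ^+ 2.
  rewrite frame; apply: eq_bigr => k _.
  by rewrite -[in LHS]Hsym -dotv_mulmx_tr Hev dotvZl; ring.
pose EE e v := Rintegral P setT (fun w => dotv (S e v w) (H *m S e v w)).
(* The factor 2 lost here cancels the [1/2] in the definition of the risk. *)
have split_le : EE eps w0 <= 2 * (EE zero w0 + EE eps 0).
  rewrite /EE -RintegralD// -RintegralZl//; last exact: integD.
  apply: le_RintegralT => [//| |w]; first by apply: integZ; exact: integD.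
  rewrite !HE -big_split /= mulr_sumr; apply: ler_sum => k _; rewrite SD -mulrDr.
  rewrite [leRHS]mulrCA; apply: ler_wpM2l; first exact: ltW.
  exact: sqrD_le.
pose C : R := (\sum_(t < T.+1) t.+1%:R)^-1.
have [r0 r0E] : exists r0, risk rho a b xstar = r0%:E.
  by eexists; exact: (riskE rho a b xstar ma mb a2 b2 opt).
have rE w : risk rho a b (acsgd_xbar alpha beta x0 (fun t => a (xi t w))
      (fun t => b (xi t w)) T) =
    (r0 + 2^-1 * C ^+ 2 * dotv (S eps w0 w) (H *m S eps w0 w))%:E.
  rewrite (risk_excess rho a b xstar ma mb a2 b2 opt) r0E acsgd_xbar_proc -/C.
  by rewrite -scalemxAr dotvZl dotvZr -EFinD /S /thstate -/H -/w0; congr (_ + _)%:E; ring.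
have iCS := integZ _ (2^-1 * C ^+ 2) _ iS.
under eq_integral do rewrite rE.
rewrite integralE_fin; last by apply: integD => //; exact: integ_cst.
rewrite (RintegralD _ (integ_cst P r0) iCS)// Rintegral_cstT RintegralZl//.
rewrite r0E -EFinB lee_fin addrAC subrr add0r -/(EE eps w0).
have CE : C = (((T%:R + 1) * (T%:R + 2) / 2))^-1.
  by rewrite /C sum_succ -(natr1 T); congr (_ * _ / _)^-1; ring.
have C0 : 0 <= C ^+ 2 by exact: sqr_ge0.
have t1 : 1 <= T%:R :> R by rewrite ler1n.
have V0 : 0 <= sigma ^+ 2 * dim%:R by rewrite mulr_ge0 ?sqr_ge0.
have varE : EE eps 0 <= 27 * (sigma ^+ 2 * dim%:R) *
    ((T%:R + 1) * (T%:R + 2) * (2 * T%:R + 3) / 6).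
  apply: le_trans var _; rewrite sum_succ_sqr -(natr1 T).
  by rewrite le_eqVlt; apply/orP; left; apply/eqP; field.
(* Constant majorant [1 / alpha], summed over [T + 1] terms. *)
have bias1 : EE zero w0 <= 3 * (T%:R + 1) * ((T%:R + 1) / alpha) * dotv w0 w0.
  have := bias (fun=> alpha^-1); rewrite sumr_const card_ord.
  rewrite -[_^-1 *+ _]mulr_natl -(natr1 T); apply.
  move=> k j; rewrite -(ler_pM2l al0) divff ?gt_eqF//.
  by apply: adjpq_al => //; exact: al_be k.
(* Majorant [(j + 1) / beta], whose sum is [(T + 1) (T + 2) / (2 beta)]. *)
have bias2 : EE zero w0 <=
    3 * (T%:R + 1) * ((T%:R + 1) * (T%:R + 2) / 2 / beta) * dotv w0 w0.
  have := bias (fun j => j.+1%:R / beta); rewrite -mulr_suml sum_succ -(natr1 T).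
  have -> : T%:R + 1 + 1 = T%:R + 2 :> R by ring.
  apply=> k j; rewrite ler_pdivlMr// mulrC.
  by apply: adjpq_be => //; exact: al_be k.
have rate := rate_arith _ _ _ _ _ (EE zero w0 + EE eps 0) t1 al0 be0 (dotvv_ge0 w0) V0
  (lerD bias1 varE) (lerD bias2 varE).
have -> : 72 * sigma ^+ 2 * dim%:R / T%:R = 72 * (sigma ^+ 2 * dim%:R) / T%:R by ring.
apply: le_trans rate; rewrite -CE.
have -> : C ^+ 2 * (EE zero w0 + EE eps 0) =
  2^-1 * C ^+ 2 * (2 * (EE zero w0 + EE eps 0)) by field.
by apply: ler_wpM2l => //; rewrite mulr_ge0.
Qed.
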